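(* Let $M\subset ISO_{q,r}(N)$ be the quantum orthogonal plane, i.e. the subalgebra generated by $x^a$ ($a=1,\dots,N$), $u$ and $v$, and let $\Gamma_M$ be the $M$-sub-bimodule of the bimodule $\Gamma$ of $1$-forms on $ISO_{q,r}(N)$ formed by all sums of elements $a\,db$ with $a,b\in M$. Assume $r\neq\pm1$, $r^N\ne1$ and $1+r^{N-2}\neq0$. Then $\Gamma_M$, as a left $M$-module (and also as a right $M$-module), is freely generated by the differentials $dx^1,\dots,dx^N$, $dL$ and $dv$, where $L=x^eC_{ef}x^f$; the same holds with $dL$ replaced by $dz$.
   Context: Let $D=N+2$. Indices $A,B,\dots$ run over the ordered set $(\circ,1,\dots,N,\bullet)$, lower-case $a,b$ over $1,\dots,N$; $\circ'=\bullet$, $\bullet'=\circ$, $a'=N+1-a$; repeated indices are summed; for $D$ odd $n_2$ is the middle index. $r,q_{AB}$ are nonzero complex numbers with $q_{AA}=r$, $q_{BA}=r^2/q_{AB}$, $q_{AB}=r^2/q_{AB'}=r^2/q_{A'B}=q_{A'B'}$ (so $q_{AA'}=r$, and $q_{An_2}=r$ if $D$ is odd). In order, $(\rho_\circ,\rho_1,\dots,\rho_N,\rho_\bullet)$ equals $(\frac D2-1,\dots,\frac12,0,-\frac12,\dots,-\frac D2+1)$ for $D$ odd and $(\frac D2-1,\dots,1,0,0,-1,\dots,-\frac D2+1)$ for $D$ even. The nonzero components of $R$ are (no sums): $R^{AA}{}_{AA}=r$ and $R^{AA'}{}_{AA'}=r^{-1}$ for $A\ne n_2$; $R^{n_2n_2}{}_{n_2n_2}=1$;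 $R^{AB}{}_{AB}=r/q_{AB}$ for $A\ne B$, $A'\ne B$; $R^{AB}{}_{BA}=r-r^{-1}$ for $A>B$, $A'\ne B$; $R^{AA'}{}_{A'A}=(r-r^{-1})(1-r^{\rho_A-\rho_{A'}})$ for $A>A'$; $R^{AA'}{}_{BB'}=-(r-r^{-1})r^{\rho_A-\rho_B}$ for $A>B$, $A'\neq B$. The metric is $C_{AB}=r^{-\rho_A}\delta_{AB'}$ with inverse $C^{AB}$; $C_{ab}$ is its restriction to lower-case indices (the metric of $SO_{q,r}(N)$). $SO_{q,r}(N+2)$ is the unital algebra generated by $T^A{}_B$ modulo $R^{AB}{}_{EF}T^E{}_CT^F{}_D=T^B{}_FT^A{}_ER^{EF}{}_{CD}$, $C^{BC}T^A{}_BT^D{}_C=C^{AD}I$, $C_{AC}T^A{}_BT^C{}_D=C_{BD}I$; it is a Hopf algebra with $\Delta(T^A{}_B)=T^A{}_C\otimes T^C{}_B$, $\varepsilon(T^A{}_B)=\delta^A_B$, $\kappa(T^A{}_B)=C^{AC}T^D{}_CC_{DB}$. $ISO_{q,r}(N)$ is the quotient of $SO_{q,r}(N+2)$ by the Hopf ideal $H$ generated by $T^a{}_\circ$, $T^\bullet{}_b$, $T^\bullet{}_\circ$; in it write $u=T^\circ{}_\circ$, $v=T^\bullet{}_\bullet=u^{-1}$, $z=T^\circ{}_\bullet$, $x^a=T^a{}_\bullet$. One has $(r^{-N/2}+r^{N/2-2})\,z=-x^bC_{ba}x^au$. Define functionals on $SO_{q,r}(N+2)$ by $L^{+A}{}_B(T^C{}_D)=R^{CA}{}_{DB}$,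 $L^{-A}{}_B(T^C{}_D)=(R^{-1})^{AC}{}_{BD}$, $L^{\pm A}{}_B(I)=\delta^A_B$, $L^{\pm A}{}_B(ab)=L^{\pm A}{}_C(a)L^{\pm C}{}_B(b)$; products of functionals are convolution products and $\kappa'(\phi)=\phi\circ\kappa$. The functionals $f^B{}_D=\kappa'(L^{+\bullet}{}_\bullet)L^{-B}{}_D$ and $\chi_B=\frac1{r-r^{-1}}[f^\bullet{}_B-\delta^\bullet_B\varepsilon]$ ($B,D\in\{\circ,1,\dots,N,\bullet\}$) vanish on $H$ and so are functionals on $ISO_{q,r}(N)$. The bimodule $\Gamma$ of $1$-forms is the free left $ISO_{q,r}(N)$-module with basis $\omega^B$, $B\in\{\circ,1,\dots,N,\bullet\}$, with right multiplication $\omega^Ba=(f^B{}_D*a)\,\omega^D$, and the differential is $da=(\chi_B*a)\,\omega^B$, where $\psi*a=(id\otimes\psi)\Delta(a)$. *)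

(* Defs.v *)
From HB Require Import structures.
From mathcomp Require Import all_boot all_order all_algebra.
From mathcomp.classical Require Import classical_sets.
From mathcomp.multinomials Require Import monalg.

Set Implicit Arguments.
Unset Strict Implicit.
Unset Printing Implicit Defensive.

Import GRing.Theory Num.Theory.
Local Open Scope ring_scope.

(** * Indices, parameters, R-matrix and metric *)

(* The ordered index set (circ, 1, ..., N, bullet) is 'I_N.+2, so that the
   prime involution A |-> A' is [rev_ord] and A = A' only for the middle index
   n_2, which exists only for N odd. *)
Definition circ {N : nat} : 'I_N.+2 := ord0.
Definition bullet {N : nat} : 'I_N.+2 := ord_max.
Definition mid {N : nat} (a : 'I_N) : 'I_N.+2 :=
  lift ord0 (widen_ord (leqnSn N) a).

Section RMatrix.
Context {K : fieldType} {N : nat}.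
Implicit Types (A B C E F : 'I_N.+2) (r s : K) (q : 'I_N.+2 -> 'I_N.+2 -> K).

Record multiparameters r q : Prop := {
  qparam_neq0 : forall A B, q A B != 0;
  qparam_diag : forall A, q A A = r;
  qparam_sym : forall A B, q B A = r ^+ 2 / q A B;
  qparam_revr : forall A B, q A B = r ^+ 2 / q A (rev_ord B);
  qparam_revl : forall A B, q A B = r ^+ 2 / q (rev_ord A) B;
  qparam_rev : forall A B, q A B = q (rev_ord A) (rev_ord B);
  qparam_mid : forall A B, rev_ord B = B -> q A B = r
}.

(* [rho2 A] is the integer 2 * rho_A; with D = N + 2 one has
   D / 2 - 1 - A = (N - 2 A) / 2 on the first half of the indices. *)
Definition rho2 A : int :=
  if (A.*2.+1 < N.+2)%N then (N%:Z - (A.*2)%:Z)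
  else if (A.*2.+1 == N.+2)%N then 0
  else (N.+2%:Z - (A.*2)%:Z).

(* [Rmat r s q A B E F] has upper indices A B and lower indices E F.
   [s] is a square root of r, needed for N odd since rho_A may then be a
   half-integer: r^rho_A is s ^ (rho2 A).  For N even only even powers of s
   occur. *)
Definition Rmat r s q A B E F : K :=
  if [&& rev_ord A != A, B == A, E == A & F == A] then r
  else if [&& rev_ord A != A, B == rev_ord A, E == A & F == rev_ord A]
    then r^-1
  else if [&& rev_ord A == A, B == A, E == A & F == A] then 1
  else if [&& A != B, rev_ord A != B, E == A & F == B] then r / q A B
  else if [&& (B < A)%N, rev_ord A != B, E == B & F == A] then r - r^-1
  else if [&& (rev_ord A < A)%N, B == rev_ord A, E == rev_ord A & F == A]
    then (r - r^-1) * (1 - s ^ (rho2 A - rho2 (rev_ord A)))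
  else if [&& (E < A)%N, rev_ord A != E, B == rev_ord A & F == rev_ord E]
    then - (r - r^-1) * s ^ (rho2 A - rho2 E)
  else 0.

(* The matrix inverse of R on the tensor square: upper indices are rows and
   lower indices are columns. *)
Definition Rinv r s q A B E F : K :=
  invmx (\matrix_(i < #|{: 'I_N.+2 * 'I_N.+2}|, j < #|{: 'I_N.+2 * 'I_N.+2}|)
           Rmat r s q (enum_val i).1 (enum_val i).2
                      (enum_val j).1 (enum_val j).2)
    (enum_rank (A, B)) (enum_rank (E, F)).

Definition metric s : 'M[K]_N.+2 :=
  \matrix_(A, B) (s ^ (- rho2 A) *+ (A == rev_ord B)).

Definition metric_inv s : 'M[K]_N.+2 := invmx (metric s).

End RMatrix.

(** * Presented algebras *)

Section Presentations.
Context {K : fieldType}.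

Inductive two_sided_ideal (A : pzRingType) (S : A -> Prop) : A -> Prop :=
| Ideal0 : two_sided_ideal S 0
| IdealD a x b y : S x -> two_sided_ideal S y ->
    two_sided_ideal S (a * x * b + y).

Inductive subalgebra (A : algType K) (S : A -> Prop) : A -> Prop :=
| SubalgGen a : S a -> subalgebra S a
| Subalg1 : subalgebra S 1
| SubalgD a b : subalgebra S a -> subalgebra S b -> subalgebra S (a + b)
| SubalgZ k a : subalgebra S a -> subalgebra S (k *: a)
| SubalgM a b : subalgebra S a -> subalgebra S b -> subalgebra S (a * b).

(* [p] exhibits B as the quotient of A by the two-sided ideal generated by
   S. *)
Definition is_quotient (A : lalgType K) (B : algType K)
    (p : {lrmorphism A -> B}) (S : A -> Prop) : Prop :=
  (forall b, exists a, p a = b) /\ (forall a, p a = 0 <-> two_sided_ideal S a).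

Definition free_algebra (N : nat) : lalgType K :=
  {malg K[{fmonom ('I_N.+2 * 'I_N.+2)%type}]}.

Definition free_gen {N : nat} (A B : 'I_N.+2) : free_algebra N :=
  mkmalgU (fmu (A, B)) 1.

(* The matrix T of generators of a quotient of the free algebra. *)
Definition gen_image {N : nat} (A : algType K)
    (p : free_algebra N -> A) (B C : 'I_N.+2) : A := p (free_gen B C).

Inductive so_relator {N : nat} (r s : K) (q : 'I_N.+2 -> 'I_N.+2 -> K) :
    free_algebra N -> Prop :=
| RelRTT A B C D : so_relator r s q
    (\sum_E \sum_F Rmat r s q A B E F *: (free_gen E C * free_gen F D)
     - \sum_E \sum_F Rmat r s q E F C D *: (free_gen B F * free_gen A E))
| RelMetricInv A D : so_relator r s q
    (\sum_B \sum_C metric_inv s B C *: (free_gen A B * free_gen D C)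
     - (metric_inv s A D)%:A)
| RelMetric B D : so_relator r s q
    (\sum_A \sum_C metric s A C *: (free_gen A B * free_gen C D)
     - (metric s B D)%:A).

Inductive iso_relator {N : nat} (A : algType K)
    (T : 'I_N.+2 -> 'I_N.+2 -> A) : A -> Prop :=
| RelColCirc a : iso_relator T (T (mid a) circ)
| RelRowBullet b : iso_relator T (T bullet (mid b))
| RelCorner : iso_relator T (T bullet circ).

End Presentations.

(** * Hopf structure and functionals *)

Section Hopf.
Context {K : fieldType} {N : nat} (A : algType K).
Implicit Types (T : 'I_N.+2 -> 'I_N.+2 -> A) (phi psi : A -> K).

(* An element of the tensor square of A is given by a list of pairs, standing
   for the sum of the corresponding pure tensors; two lists give the same
   tensor iff all bilinear maps agree on them. *)
Definition tensor_eq (t t' : seq (A * A)) : Prop :=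
  forall (V : lmodType K) (beta : A -> A -> V),
    (forall a, linear (beta a)) -> (forall b, linear (beta^~ b)) ->
    \sum_(p <- t) beta p.1 p.2 = \sum_(p <- t') beta p.1 p.2.

(* T generates A in the cases of interest, so these conditions determine
   Delta up to [tensor_eq]. *)
Record is_coproduct T (Delta : A -> seq (A * A)) : Prop := {
  coproduct_linear : forall k a b,
    tensor_eq (Delta (k *: a + b))
      ([seq (k *: x.1, x.2) | x <- Delta a] ++ Delta b);
  coproduct1 : tensor_eq (Delta 1) [:: (1, 1)];
  coproductM : forall a b,
    tensor_eq (Delta (a * b))
      [seq (x.1 * y.1, x.2 * y.2) | x <- Delta a, y <- Delta b];
  coproduct_gen : forall B C,
    tensor_eq (Delta (T B C)) [seq (T B E, T E C) | E <- enum 'I_N.+2]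
}.

Definition is_counit T (eps : {lrmorphism A -> K^o}) : Prop :=
  forall B C, eps (T B C) = (B == C)%:R.

Record is_antipode T (s : K) (kappa : A -> A) : Prop := {
  antipode_linear : linear kappa;
  antipode1 : kappa 1 = 1;
  antipodeM : forall a b, kappa (a * b) = kappa b * kappa a;
  antipode_gen : forall B C, kappa (T B C) =
    \sum_E \sum_F (metric_inv s B E * metric s F C) *: T F E
}.

(* A matrix of linear functionals with the given values on the generators,
   extended to products by matrix multiplication. *)
Record is_matrix_functional T (L : 'I_N.+2 -> 'I_N.+2 -> A -> K)
    (val : 'I_N.+2 -> 'I_N.+2 -> 'I_N.+2 -> 'I_N.+2 -> K) : Prop := {
  functional_linear : forall B C, linear (L B C : A -> K^o);
  functional1 : forall B C, L B C 1 = (B == C)%:R;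
  functionalM : forall B C a b, L B C (a * b) = \sum_E L B E a * L E C b;
  functional_gen : forall B C E F, L B C (T E F) = val B C E F
}.

Definition is_Lplus T r s q L : Prop :=
  is_matrix_functional T L (fun B C E F => Rmat r s q E B F C).
Definition is_Lminus T r s q L : Prop :=
  is_matrix_functional T L (fun B C E F => Rinv r s q B E C F).

Definition convolution (Delta : A -> seq (A * A)) phi psi : A -> K :=
  fun a => \sum_(x <- Delta a) phi x.1 * psi x.2.

Definition left_action (Delta : A -> seq (A * A)) psi : A -> A :=
  fun a => \sum_(x <- Delta a) psi x.2 *: x.1.

Definition f_fun (Delta : A -> seq (A * A)) (kappa : A -> A)
    (Lp Lm : 'I_N.+2 -> 'I_N.+2 -> A -> K) (B D : 'I_N.+2) : A -> K :=
  convolution Delta (Lp bullet bullet \o kappa) (Lm B D).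

Definition chi_fun (r : K) (eps : A -> K) (f : 'I_N.+2 -> 'I_N.+2 -> A -> K)
    (B : 'I_N.+2) : A -> K :=
  fun a => (r - r^-1)^-1 * (f bullet B a - (bullet == B)%:R * eps a).

End Hopf.

(** * Passing to a quotient *)

Section Induced.
Context {K : fieldType} {A B : algType K} (pi : A -> B).

(* A chosen preimage; the structures below do not depend on the choice when
   they are compatible with the quotient map [pi]. *)
Definition representative (b : B) : A := xget 0 (fun a => pi a = b).

Definition induced_functional (phi : A -> K) : B -> K :=
  phi \o representative.

Definition induced_coproduct (Delta : A -> seq (A * A)) : B -> seq (B * B) :=
  fun b => [seq (pi x.1, pi x.2) | x <- Delta (representative b)].

End Induced.

(** * One-forms *)

(* The free left A-module with basis omega^B, B in 'I_N.+2: the row vector [w]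
   stands for the sum over B of (w 0 B) omega^B. *)
Definition forms (N : nat) (A : nzRingType) : lmodType A := 'rV[A]_N.+2.

Definition form_lmul {N : nat} {A : nzRingType} (a : A) (w : forms N A) :
  forms N A := a *: w.

Section Forms.
Context {K : fieldType} {N : nat} {A : algType K}.
Variables (Delta : A -> seq (A * A)).
Variables (f : 'I_N.+2 -> 'I_N.+2 -> A -> K) (chi : 'I_N.+2 -> A -> K).

(* (w_B omega^B) a = w_B (f^B_D * a) omega^D *)
Definition form_rmul (a : A) (w : forms N A) : forms N A :=
  \row_D \sum_B w 0 B * left_action Delta (f B D) a.

Definition form_diff (a : A) : forms N A :=
  \row_B left_action Delta (chi B) a.

(* All finite sums of elements a db with a, b in M. *)
Definition forms_on (M : A -> Prop) (w : forms N A) : Prop :=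
  exists t : seq (A * A),
    (forall x, x \in t -> M x.1 /\ M x.2) /\
    w = \sum_(x <- t) form_lmul x.1 (form_diff x.2).

End Forms.

Section Freeness.
Context {A : nzRingType} {V : zmodType}.

Record is_submodule (act : A -> V -> V) (M : A -> Prop) (G : V -> Prop) :
    Prop := {
  submodule0 : G 0;
  submoduleD : forall w w', G w -> G w' -> G (w + w');
  submoduleZ : forall m w, M m -> G w -> G (act m w)
}.

Record freely_generated (act : A -> V -> V) (M : A -> Prop) (G : V -> Prop)
    (I : finType) (e : I -> V) : Prop := {
  free_submodule : is_submodule act M G;
  free_mem : forall i, G (e i);
  free_coords : forall w, G w -> exists! c : {ffun I -> A},
    (forall i, M (c i)) /\ w = \sum_i act (c i) (e i)
}.

End Freeness.

(** * The quantum orthogonal plane *)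

Section Plane.
Context {K : fieldType} {N : nat} {A : algType K}.
Variable (T : 'I_N.+2 -> 'I_N.+2 -> A).

Definition gen_x (a : 'I_N) : A := T (mid a) bullet.
Definition gen_u : A := T circ circ.
Definition gen_v : A := T bullet bullet.
Definition gen_z : A := T circ bullet.

Definition quad_L (s : K) : A :=
  \sum_e \sum_f metric s (mid e) (mid f) *: (gen_x e * gen_x f).

Inductive plane_gen : A -> Prop :=
| PlaneX a : plane_gen (gen_x a)
| PlaneU : plane_gen gen_u
| PlaneV : plane_gen gen_v.

Definition plane : A -> Prop := subalgebra plane_gen.

(* The family dx^1, ..., dx^N, dy, dv. *)
Definition diff_family (d : A -> forms N A) (y : A) (i : 'I_N + bool) :
    forms N A :=
  match i with
  | inl a => d (gen_x a)
  | inr false => d y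
  | inr true => d gen_v
  end.

End Plane.

(* Main.v *)
(** The functional [f B D] is a character times [L^-], so on the generators it
    is given by entries of the inverse R-matrix.  Only entries with an index
    [circ] or [bullet] matter; they follow from the triangularity of R and from
    evaluating [L^-] on the metric relations, which avoids inverting R.

    As [chi B] is [f bullet B] minus the counit, the differential is inner:
    [d a = (r - r^-1)^-1 (w a - a w)] with [w = omega^bullet].  Put
    [eta^a = sum_b (q_(b,bullet) / r) T^a_b omega^b].  The forms [w], [eta^a]
    and [omega^circ] commute with [x^a], [u], [v] up to coefficients in M, so
    their M-span, left or right, is a bimodule containing dM; it is also the
    span of the dx^a, dz and dv.

    Independence: [d (T^C_bullet)] equals [sum_D h_D T^C_D omega^D], and also
    [sum_D omega^D (h'_D T^C_D)], with nonzero scalars [h_D], [h'_D], and the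
    matrix T is invertible.  Right independence of the [omega^D] themselves
    comes from the convolution inverse of f, built from f and the antipode.

    Finally L is a multiple of [v z], so that dL is [v dz + z dv], as well as
    [(dz) v + (dv) z], up to a factor, and dz can be exchanged for dL. *)

Require Import Defs.
From HB Require Import structures.
From mathcomp Require Import all_boot all_order all_algebra.
From mathcomp Require Import complex.
From mathcomp.classical Require Import classical_sets.
From mathcomp.reals Require Import reals.
From mathcomp.multinomials Require Import monalg.
From mathcomp Require Import zify ring.

Set Implicit Arguments.
Unset Strict Implicit.
Unset Printing Implicit Defensive.

Import GRing.Theory Num.Theory.
Local Open Scope ring_scope.

(** * Indices and the R-matrix *)

(** Two obstacles shape the proof. The inverse of R is given only as [invmx], which also has a value
    on singular matrices, so R must be shown invertible. This comes from the existence of L^-: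
    evaluated on the metric relation it gives a crossing identity that exhibits a one-sided inverse
    of [invmx R]. The other obstacle is that the coproduct and the functionals on ISO go through
    chosen representatives. So the left actions are handled as matrices of operators, a notion
    determined by the values on generators and stable under quotients; identities such as the
    invertibility of f are then checked on generators.

    The hypotheses on r enter as follows. With r different from 1 and -1, r - 1/r can be divided by,
    which makes d an inner derivation. In dz the coefficient of omega^circ is, up to a nonzero
    scalar, (r^N - 1) u, whether written on the left or on the right, so dz recovers omega^circ when
    r^N is not 1. Finally L = - (r^(2-N/2) + r^(N/2)) v z, and this factor is nonzero exactly when 1
    + r^(N-2) is. *)

Section Indices.
Context {N : nat}.
Implicit Types (A B : 'I_N.+2) (a b : 'I_N).

Lemma rev_circ : rev_ord (@circ N) = bullet.
Proof. by apply: val_inj; rewrite /= subSS subn0. Qed.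

Lemma rev_bullet : rev_ord (@bullet N) = circ.
Proof. by rewrite -rev_circ rev_ordK. Qed.

Lemma rev_mid a : rev_ord (mid a) = mid (rev_ord a).
Proof. by apply: val_inj; have := ltn_ord a; rewrite /= /bump; lia. Qed.

Lemma mid_circ a : (mid a == circ) = false.
Proof. by []. Qed.

Lemma circ_mid a : (circ == mid a) = false.
Proof. by []. Qed.

Lemma mid_bullet a : (mid a == bullet) = false.
Proof. by apply/negbTE; rewrite -val_eqE /= /bump; have := ltn_ord a; lia. Qed.

Lemma bullet_mid a : (bullet == mid a) = false.
Proof. by rewrite eq_sym mid_bullet. Qed.

Lemma circ_bullet : (@circ N == bullet) = false.
Proof. by []. Qed.

Lemma bullet_circ : (@bullet N == circ) = false.
Proof. by []. Qed.

Lemma mid_inj : injective (@mid N).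
Proof.
by move=> a b /lift_inj/(congr1 val) ?; apply: val_inj.
Qed.

Lemma mid_eq a b : (mid a == mid b) = (a == b).
Proof. exact: (inj_eq mid_inj). Qed.

Definition index_eqE := (rev_circ, rev_bullet, rev_mid, mid_circ, circ_mid,
  mid_bullet, bullet_mid, circ_bullet, bullet_circ, mid_eq, eqxx).

Lemma big_index (V : nmodType) (F : 'I_N.+2 -> V) :
  \sum_A F A = F circ + \sum_a F (mid a) + F bullet.
Proof.
rewrite big_ord_recl big_ord_recr addrA; congr (_ + _ + F _).
exact: val_inj.
Qed.

Lemma indexP A : [\/ A = circ, exists a, A = mid a | A = bullet].
Proof.
case: (unliftP ord0 A) => [j ->|->]; last by constructor 1.
case: (unliftP ord_max j) => [k ->|->]; last first.
  by constructor 3; apply: val_inj.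
constructor 2; exists k; congr lift; apply: val_inj => /=.
by rewrite /bump leqNgt ltn_ord.
Qed.

Lemma rho2_rev A : rho2 (rev_ord A) = - rho2 A.
Proof.
rewrite /rho2 /=; have := ltn_ord A.
by do ![case: ifP]; lia.
Qed.

Lemma rho2_circ : rho2 (@circ N) = N%:Z.
Proof. by rewrite /rho2 /= subr0. Qed.

End Indices.

Section REntries.
Context {K : fieldType} {N : nat} (r s : K) (q : 'I_N.+2 -> 'I_N.+2 -> K).
Implicit Types (A B C D E F : 'I_N.+2) (a b c d e f : 'I_N).

Local Notation R := (Rmat r s q).
Local Notation la := (r - r^-1).
Local Notation sg A := (s ^ (rho2 A)).

Lemma Rmat_support A B C D : R A B C D != 0 ->
  [\/ C = A /\ D = B, C = B /\ D = A | B = rev_ord A /\ D = rev_ord C].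
Proof.
rewrite /Rmat.
case: ifP => [/and4P[_ /eqP-> /eqP-> /eqP->] _|_]; first by constructor 1.
case: ifP => [/and4P[_ /eqP-> /eqP-> /eqP->] _|_]; first by constructor 1.
case: ifP => [/and4P[_ /eqP-> /eqP-> /eqP->] _|_]; first by constructor 1.
case: ifP => [/and4P[_ _ /eqP-> /eqP->] _|_]; first by constructor 1.
case: ifP => [/and4P[_ _ /eqP-> /eqP->] _|_]; first by constructor 2.
case: ifP => [/and4P[_ /eqP-> /eqP-> /eqP->] _|_].
  by constructor 3; rewrite rev_ordK.
case: ifP => [/and4P[_ _ /eqP-> /eqP->] _|_]; first by constructor 3.
by rewrite eqxx.
Qed.

(** Triangularity of R. Combined with [Rmat_support], an index [circ] or [bullet] in a suitable slot
    leaves a single entry in a row or a column, and such entries can be inverted one by one. *)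
Lemma Rmat_lower A B C D : R A B C D != 0 -> (C <= A)%N /\ (B <= D)%N.
Proof.
have [[[hA hB] hC] hD] := (ltn_ord A, ltn_ord B, ltn_ord C, ltn_ord D).
rewrite /Rmat.
case: ifP => [/and4P[_ /eqP-> /eqP-> /eqP->] _|_]; first by [].
case: ifP => [/and4P[_ /eqP-> /eqP-> /eqP->] _|_]; first by [].
case: ifP => [/and4P[_ /eqP-> /eqP-> /eqP->] _|_]; first by [].
case: ifP => [/and4P[_ _ /eqP-> /eqP->] _|_]; first by [].
case: ifP => [/and4P[H _ /eqP-> /eqP->] _|_]; first by split; apply: ltnW.
case: ifP => [/and4P[H /eqP-> /eqP-> /eqP->] _|_]; first by split; apply: ltnW.
case: ifP => [/and4P[H _ /eqP-> /eqP->] _|_]; last by rewrite eqxx.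
by split; [apply: ltnW | rewrite /=; lia].
Qed.

Lemma Rmat_row_bullet B E F :
  R B bullet E F != 0 -> E = B /\ F = bullet.
Proof.
move=> H; have [_ hF] := Rmat_lower H.
have eF : F = bullet.
  by apply: val_inj => /=; have := ltn_ord F; rewrite /= in hF; lia.
case: (Rmat_support H) => [[//]|[-> eB]|[eB eE]]; first by rewrite -eB eF.
by split=> //; apply: rev_ord_inj; rewrite -eE -eB.
Qed.

Lemma Rmat_row_circ B E F : R circ B E F != 0 -> E = circ /\ F = B.
Proof.
move=> H; have [hE _] := Rmat_lower H.
have eE : E = circ by apply: val_inj => /=; rewrite /= in hE; lia.
case: (Rmat_support H) => [[//]|[eB ->]|[-> ->]]; first by rewrite -eB eE.
by rewrite eE.
Qed.

Lemma Rmat_col_circ A B D : R A B D circ != 0 -> A = D /\ B = circ.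
Proof.
move=> H; have [_ hB] := Rmat_lower H.
have eB : B = circ by apply: val_inj => /=; rewrite /= in hB; lia.
case: (Rmat_support H) => [[->]//|[-> eA]|[eA eD]]; first by rewrite -eA eB.
by split=> //; apply: rev_ord_inj; rewrite -eA eB -eD.
Qed.

Lemma Rmat_col_bullet A B D : R A B bullet D != 0 -> A = bullet /\ B = D.
Proof.
move=> H; have [hA _] := Rmat_lower H.
have eA : A = bullet.
  by apply: val_inj => /=; have := ltn_ord A; rewrite /= in hA; lia.
case: (Rmat_support H) => [[_ ->]//|[eB ->]|[-> ->]]; first by rewrite -eB.
by rewrite eA.
Qed.

Lemma Rmat_col_mid_bullet A B d : R A B (mid d) bullet != 0 ->
  (A = mid d /\ B = bullet) \/ (A = bullet /\ B = mid d).
Proof.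
move=> H; case: (Rmat_support H) => [[-> ->]|[-> ->]|[_]]; [by left|by right|].
by move/eqP; rewrite !index_eqE.
Qed.

Lemma Rmat_col_circ_mid A B d : R A B circ (mid d) != 0 ->
  (A = circ /\ B = mid d) \/ (A = mid d /\ B = circ).
Proof.
move=> H; case: (Rmat_support H) => [[-> ->]|[-> ->]|[_]]; [by left|by right|].
by move/eqP; rewrite !index_eqE.
Qed.

Lemma Rmat_bullet2 : R bullet bullet bullet bullet = r.
Proof. by rewrite /Rmat !index_eqE. Qed.

Lemma Rmat_circ2 : R circ circ circ circ = r.
Proof. by rewrite /Rmat !index_eqE. Qed.

Lemma Rmat_circ_bullet : R circ bullet circ bullet = r^-1.
Proof. by rewrite /Rmat !index_eqE. Qed.

Lemma Rmat_bullet_circ : R bullet circ bullet circ = r^-1.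
Proof. by rewrite /Rmat !index_eqE. Qed.

Lemma Rmat_diag A B : A != B -> rev_ord A != B -> R A B A B = r / q A B.
Proof.
move=> nAB nAB'.
by rewrite /Rmat !eqxx !(eq_sym B) (negbTE nAB) (negbTE nAB') ?andbF /=.
Qed.

Lemma Rmat_swap A B :
  (B < A)%N -> A != B -> rev_ord A != B -> R A B B A = la.
Proof.
move=> lBA nAB nAB'.
by rewrite /Rmat !eqxx !(eq_sym B) (negbTE nAB) (negbTE nAB') lBA ?andbF.
Qed.

Lemma sg_rev A : sg (rev_ord A) = (sg A)^-1.
Proof. by rewrite rho2_rev invr_expz. Qed.

Lemma sg_bullet : sg (@bullet N) = (sg (@circ N))^-1.
Proof. by rewrite -rev_circ sg_rev. Qed.

Lemma Rmat_row_bullet_circ E F : s != 0 -> R bullet circ E F =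
  if E == bullet then r^-1 *+ (F == circ) else
  if E == circ then la * (1 - (sg (@circ N)) ^- 2) *+ (F == bullet) else
  - la * (sg (@circ N))^-1 / sg E *+ (F == rev_ord E).
Proof.
move=> s0.
case: (indexP E) => [-> | [e ->] | ->]; rewrite /Rmat !index_eqE /=.
- case: eqP => // _; rewrite mulr1n; congr (_ * (1 - _)).
  by rewrite expfzDr // -invr_expz sg_bullet expr2 invfM.
- rewrite /bump leq0n add1n ltnS ltn_ord /=; case: eqP => // _.
  by rewrite expfzDr // -invr_expz sg_bullet mulr1n mulrA.
by rewrite ltnn; case: eqP.
Qed.

End REntries.

(** * Entries of the inverse R-matrix *)

Section RInverse.
Context {K : fieldType} {N : nat} (r s : K) (q : 'I_N.+2 -> 'I_N.+2 -> K).
Implicit Types (A B C D E F : 'I_N.+2) (a b c d e f : 'I_N).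

Local Notation R := (Rmat r s q).
Local Notation X := (Rinv r s q).

Definition Rmx := \matrix_(i < #|{: 'I_N.+2 * 'I_N.+2}|,
    j < #|{: 'I_N.+2 * 'I_N.+2}|)
  Rmat r s q (enum_val i).1 (enum_val i).2 (enum_val j).1 (enum_val j).2.

Lemma big_enum_pair (V : nmodType) (G : 'I_#|{: 'I_N.+2 * 'I_N.+2}| -> V) :
  \sum_i G i = \sum_A \sum_B G (enum_rank (A, B)).
Proof.
rewrite pair_big /= (reindex enum_rank) /=; last exact/onW_bij/enum_rank_bij.
by apply: eq_bigr => -[].
Qed.

(** [invmx] returns a singular matrix unchanged, so R is invertible as soon as its [invmx] has a
    one-sided inverse. *)
Lemma Rmx_unit (Y : 'I_N.+2 -> 'I_N.+2 -> 'I_N.+2 -> 'I_N.+2 -> K) :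
  (forall A B C D, \sum_E \sum_F Y A B E F * X E F C D
     = ((A == C) && (B == D))%:R) ->
  Rmx \in unitmx.
Proof.
move=> H; rewrite -unitmx_inv.
pose Ym := \matrix_(i < #|{: 'I_N.+2 * 'I_N.+2}|,
    j < #|{: 'I_N.+2 * 'I_N.+2}|)
  Y (enum_val i).1 (enum_val i).2 (enum_val j).1 (enum_val j).2.
suff /mulmx1_unit[]: Ym *m invmx Rmx = 1%:M by [].
apply/matrixP => i j; rewrite !mxE big_enum_pair.
transitivity (\sum_A \sum_B Y (enum_val i).1 (enum_val i).2 A B *
  X A B (enum_val j).1 (enum_val j).2).
  apply: eq_bigr => A _; apply: eq_bigr => B _.
  rewrite mxE enum_rankK; congr (_ * invmx _ _ _).
  by rewrite -surjective_pairing enum_valK.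
by rewrite H -(inj_eq enum_val_inj) -xpair_eqE -!surjective_pairing.
Qed.

Section Unit.
Hypothesis Ru : Rmx \in unitmx.

Lemma Rmat_Rinv A B C D :
  \sum_E \sum_F R A B E F * X E F C D = ((A == C) && (B == D))%:R.
Proof.
have /matrixP/(_ (enum_rank (A, B)) (enum_rank (C, D))) := mulmxV Ru.
rewrite !mxE (inj_eq enum_rank_inj) xpair_eqE => <-.
rewrite big_enum_pair; apply: eq_bigr => E _; apply: eq_bigr => F _.
by rewrite mxE !enum_rankK.
Qed.

Lemma Rinv_Rmat A B C D :
  \sum_E \sum_F X A B E F * R E F C D = ((A == C) && (B == D))%:R.
Proof.
have /matrixP/(_ (enum_rank (A, B)) (enum_rank (C, D))) := mulVmx Ru.
rewrite !mxE (inj_eq enum_rank_inj) xpair_eqE => <-.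
rewrite big_enum_pair; apply: eq_bigr => E _; apply: eq_bigr => F _.
by rewrite [X in _ = _ * X]mxE !enum_rankK.
Qed.

(** A weight conserved by R is a diagonal matrix commuting with R, hence with the inverse of R; the
    claim compares entries. *)
Lemma Rinv_weight (t : 'I_N.+2 -> 'I_N.+2 -> K) :
  (forall A B C D, R A B C D != 0 -> t A B = t C D) ->
  forall A B C D, X A B C D != 0 -> t A B = t C D.
Proof.
move=> tR A B C D XN0.
pose dt := \row_(i < #|{: 'I_N.+2 * 'I_N.+2}|)
  t (enum_val i).1 (enum_val i).2.
have cR : Rmx *m diag_mx dt = diag_mx dt *m Rmx.
  rewrite mul_mx_diag mul_diag_mx; apply/matrixP => i j; rewrite !mxE.
  set x := R _ _ _ _; have [->|/tR->] := eqVneq x 0; first by rewrite mulr0 mul0r.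
  exact: mulrC.
have : diag_mx dt *m invmx Rmx = invmx Rmx *m diag_mx dt.
  by rewrite -[LHS](mulKmx Ru) (mulmxA Rmx) cR -(mulmxA _ Rmx) mulmxV // mulmx1.
rewrite mul_mx_diag mul_diag_mx.
move/matrixP/(_ (enum_rank (A, B)) (enum_rank (C, D))).
by rewrite !mxE !enum_rankK /= mulrC => /(mulfI XN0).
Qed.

End Unit.
End RInverse.

Lemma sum_only1 (V : nmodType) (I : finType) (i0 : I) (G : I -> V) :
  (forall i, G i != 0 -> i = i0) -> \sum_i G i = G i0.
Proof.
move=> H; rewrite (bigD1 i0) //= big1 ?addr0 // => i /eqP ni.
by apply/eqP; apply: contraT => /H.
Qed.

Lemma sum_pair_only1 (V : nmodType) (I J : finType) (i0 : I) (j0 : J)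
    (G : I -> J -> V) :
  (forall i j, G i j != 0 -> i = i0 /\ j = j0) ->
  \sum_i \sum_j G i j = G i0 j0.
Proof.
move=> H; rewrite pair_big /= (@sum_only1 _ _ (i0, j0)) //=.
by move=> [i j] /= /H[-> ->].
Qed.

Lemma sum_pair_only2 (V : nmodType) (I J : finType) (i0 i1 : I) (j0 j1 : J)
    (G : I -> J -> V) :
  (i0, j0) != (i1, j1) ->
  (forall i j, G i j != 0 -> i = i0 /\ j = j0 \/ i = i1 /\ j = j1) ->
  \sum_i \sum_j G i j = G i0 j0 + G i1 j1.
Proof.
move=> n01 H; rewrite pair_big /= (bigD1 (i0, j0)) //=; congr (_ + _).
rewrite (bigD1 (i1, j1)) /= 1?eq_sym // big1 ?addr0 // => -[i j] /andP[/eqP n0 /eqP n1].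
by apply/eqP; apply: contraT => /= /H[[e1 e2]|[e1 e2]]; [case: n0|case: n1]; rewrite e1 e2.
Qed.

Lemma mul_neq0l (K : fieldType) (x y : K) : x * y != 0 -> x != 0.
Proof. by rewrite mulf_eq0 negb_or => /andP[]. Qed.

Lemma mul_neq0r (K : fieldType) (x y : K) : x * y != 0 -> y != 0.
Proof. by rewrite mulf_eq0 negb_or => /andP[]. Qed.

Section Entries.
Context {K : fieldType} {N : nat} (r s : K) (q : 'I_N.+2 -> 'I_N.+2 -> K).
Implicit Types (A B C D E F : 'I_N.+2) (a b c d e f : 'I_N).

Local Notation R := (Rmat r s q).
Local Notation X := (Rinv r s q).
Local Notation la := (r - r^-1).
Local Notation sg A := (s ^ (rho2 A)).

Hypotheses (r0 : r != 0) (s0 : s != 0) (qP : multiparameters r q).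
Hypothesis Ru : Rmx r s q \in unitmx.

(* The diagonal value of the character [L^+ bullet bullet] at [T B B]. *)
Definition gfac B : K := Rmat r s q B bullet B bullet.

Lemma gfac_bullet : gfac bullet = r.
Proof. exact: Rmat_bullet2. Qed.

Lemma gfac_circ : gfac circ = r^-1.
Proof. exact: Rmat_circ_bullet. Qed.

Lemma gfac_mid a : gfac (mid a) = r / q (mid a) bullet.
Proof. by rewrite /gfac Rmat_diag ?index_eqE. Qed.

Lemma q_neq0 A B : q A B != 0. Proof. exact: qparam_neq0 qP A B. Qed.
Local Hint Resolve q_neq0 : core.

Lemma q_circ_mid a : q circ (mid a) = q (mid a) bullet.
Proof. by rewrite (qparam_revl qP) rev_circ (qparam_sym qP (mid a)); field; rewrite r0 q_neq0. Qed.

Lemma q_bullet_mid a : q bullet (mid a) = r ^+ 2 / q (mid a) bullet.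
Proof. exact: qparam_sym. Qed.

Lemma q_mid_circ a : q (mid a) circ = r ^+ 2 / q (mid a) bullet.
Proof. by rewrite (qparam_sym qP circ) q_circ_mid. Qed.

Lemma q_rev_bullet a : q (mid (rev_ord a)) bullet = r ^+ 2 / q (mid a) bullet.
Proof. by rewrite -rev_mid (qparam_revl qP) rev_ordK. Qed.

Lemma gfac_neq0 B : gfac B != 0.
Proof.
case: (indexP B) => [-> | [e ->] | ->];
  by rewrite ?gfac_circ ?gfac_bullet ?gfac_mid ?mulf_neq0 ?invr_eq0.
Qed.

Lemma gfac_rev B : gfac (rev_ord B) = (gfac B)^-1.
Proof.
case: (indexP B) => [-> | [e ->] | ->];
  rewrite ?index_eqE ?gfac_circ ?gfac_bullet ?gfac_mid ?invrK //.
by rewrite q_rev_bullet; field; rewrite r0 q_neq0.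
Qed.

(** Row (B, bullet) of R has one entry, so that row of [R * Rinv = 1] can be solved at once. The
    next two lemmas treat one-entry columns through [Rinv * R = 1]. *)
Lemma Rinv_row_bullet B C D :
  X B bullet C D = (gfac B)^-1 *+ ((B == C) && (bullet == D)).
Proof.
have := Rmat_Rinv Ru B bullet C D.
rewrite (@sum_pair_only1 _ _ _ B bullet); last first.
  by move=> E F /mul_neq0l /Rmat_row_bullet.
move=> H; apply: (mulfI (gfac_neq0 B)); rewrite H.
by rewrite mulrnAr mulfV ?gfac_neq0.
Qed.

Lemma Rinv_col_circ A B D :
  X A B D circ = (R D circ D circ)^-1 *+ ((A == D) && (B == circ)).
Proof.
have := Rinv_Rmat Ru A B D circ.
rewrite (@sum_pair_only1 _ _ _ D circ); last first.
  by move=> E F /mul_neq0r /Rmat_col_circ.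
have n0 : R D circ D circ != 0.
  case: (indexP D) => [-> | [d ->] | ->];
  by rewrite ?Rmat_circ2 ?Rmat_bullet_circ ?Rmat_diag ?mulf_neq0 ?invr_eq0 ?index_eqE.
by move=> H; apply: (mulIf n0); rewrite H mulrnAl mulVf.
Qed.

Lemma Rinv_col_bullet A B D :
  X A B bullet D = (R bullet D bullet D)^-1 *+ ((A == bullet) && (B == D)).
Proof.
have := Rinv_Rmat Ru A B bullet D.
rewrite (@sum_pair_only1 _ _ _ bullet D); last first.
  by move=> E F /mul_neq0r /Rmat_col_bullet.
have n0 : R bullet D bullet D != 0.
  case: (indexP D) => [-> | [d ->] | ->];
  by rewrite ?Rmat_bullet2 ?Rmat_bullet_circ ?Rmat_diag ?mulf_neq0 ?invr_eq0 ?index_eqE.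
by move=> H; apply: (mulIf n0); rewrite H mulrnAl mulVf.
Qed.

(** Column (mid d, bullet) of R has two entries, and one of them meets the column (bullet, mid d) of
    [Rinv], already known. One equation for one unknown entry remains. *)
Lemma Rinv_col_mid_bullet A B d : X A B (mid d) bullet =
  (q (mid d) bullet / r) *+ ((A == mid d) && (B == bullet))
  - la *+ ((A == bullet) && (B == mid d)).
Proof.
have := Rinv_Rmat Ru A B (mid d) bullet.
rewrite (@sum_pair_only2 _ _ _ (mid d) bullet bullet (mid d)); first last.
- by move=> E F /mul_neq0r /Rmat_col_mid_bullet.
- by rewrite xpair_eqE !index_eqE.
rewrite -/(gfac _) gfac_mid Rmat_swap ?index_eqE //; last first.
  by rewrite /= /bump leq0n add1n ltnS.
rewrite Rinv_col_bullet Rmat_diag ?index_eqE // q_bullet_mid.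
move: (X _ _ _ _) (_ && _) (_ && _) => x b1 b2 /(canRL (addrK _)) H.
have Q0 := q_neq0 (mid d) bullet.
apply: (@mulIf _ (r / q (mid d) bullet)); first by rewrite mulf_neq0 ?invr_eq0.
by rewrite {}H; case: b1; case: b2; rewrite /= ?mulr1n ?mulr0n; field; rewrite r0 Q0.
Qed.

Lemma Rinv_col_circ_mid A B h : X A B circ (mid h) =
  (q (mid h) bullet / r) *+ ((A == circ) && (B == mid h))
  - la *+ ((A == mid h) && (B == circ)).
Proof.
have := Rinv_Rmat Ru A B circ (mid h).
rewrite (@sum_pair_only2 _ _ _ circ (mid h) (mid h) circ); first last.
- by move=> E F /mul_neq0r /Rmat_col_circ_mid.
- by rewrite xpair_eqE !index_eqE.
rewrite Rmat_swap ?index_eqE // Rinv_col_circ !Rmat_diag ?index_eqE //.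
rewrite q_circ_mid q_mid_circ.
move: (X _ _ _ _) (_ && _) (_ && _) => x b1 b2 /(canRL (addrK _)) H.
have Q0 := q_neq0 (mid h) bullet.
apply: (@mulIf _ (r / q (mid h) bullet)); first by rewrite mulf_neq0 ?invr_eq0.
by rewrite {}H; case: b1; case: b2; rewrite /= ?mulr1n ?mulr0n; field; rewrite r0 Q0.
Qed.

(** Being a pair (A, A') is a weight conserved by R: the first two shapes of [Rmat_support] keep the
    pair up to order, the third joins two such pairs. *)
Lemma Rinv_rev_support A B C D :
  X A B C D != 0 -> (B == rev_ord A) = (D == rev_ord C).
Proof.
move=> XN0; have : (B == rev_ord A)%:R = (D == rev_ord C)%:R :> K.
  apply: (Rinv_weight Ru (t := fun A B => (B == rev_ord A)%:R)) XN0.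
  move=> {}A {}B {}C {}D /Rmat_support[[-> ->]//|[-> ->]|[-> ->]].
    by rewrite eq_sym (canF_eq (@rev_ordK _)).
  by rewrite !eqxx.
case: (_ == _); case: (_ == _) => // /eqP; rewrite ?oner_eq0 //.
by rewrite eq_sym oner_eq0.
Qed.

Lemma Rinv_col_circ_bullet_support A B :
  X A B circ bullet != 0 -> B = rev_ord A.
Proof. by move=> /Rinv_rev_support; rewrite rev_circ eqxx => /eqP. Qed.

Lemma Rinv_sg_weight A B C D : X A B C D != 0 ->
  sg A * sg B = sg C * sg D.
Proof.
move=> /(Rinv_weight Ru (t := fun A B => sg A * sg B)); apply.
move=> {}A {}B {}C {}D /Rmat_support[[-> ->]//|[-> ->]|[-> ->]].
  exact: mulrC.
by rewrite !sg_rev !mulfV ?expfz_neq0.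
Qed.

(** * Entries of the inverse obtained from the crossing relation *)

Section Crossing.
Hypothesis cross : forall A B D H,
  \sum_E \sum_F (sg F)^-1 * X A F E B * X E (rev_ord F) D H
  = (sg B)^-1 *+ ((A == D) && (B == rev_ord H)).

(** Crossing at (mid a, bullet, circ, mid a) has two surviving terms: in one the unknown entry
    multiplies a known nonzero entry, and the other contains known entries only. *)
Lemma Rinv_mid_circ_bullet a :
  X (mid a) (mid (rev_ord a)) circ bullet = la * sg (@circ N) / sg (mid a).
Proof.
have := cross (mid a) bullet circ (mid a).
rewrite !index_eqE /= mulr0n.
rewrite (@sum_pair_only2 _ _ _ circ (mid a) (rev_ord (mid a)) bullet);
  first last.
- move=> E F; case: (indexP E) => [-> | [e ->] | ->] N0.
  + by left; split=> //; apply: Rinv_col_circ_bullet_support (mul_neq0r (mul_neq0l N0)).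
  + move: (mul_neq0r N0).
    rewrite Rinv_col_circ_mid !index_eqE /= mulr0n sub0r oppr_eq0.
    case: (e =P a) => [->|_] /=; last by rewrite mulr0n eqxx.
    case: (rev_ord F =P circ) => [eF _|_] /=; last by rewrite mulr0n eqxx.
    by right; rewrite -(rev_ordK F) eF rev_circ.
  + by move: (mul_neq0r (mul_neq0l N0)); rewrite Rinv_col_bullet !index_eqE.
- by rewrite xpair_eqE !index_eqE.
rewrite rev_bullet !rev_ordK rev_mid Rinv_col_mid_bullet !Rinv_col_circ_mid !index_eqE /=.
rewrite !mulr1n !mulr0n -rev_mid !sg_rev sg_bullet !invrK.
have Q0 := q_neq0 (mid a) bullet.
have S0 := @expfz_neq0 _ s (rho2 (mid a)) s0.
have S1 := @expfz_neq0 _ s (rho2 (@circ N)) s0.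
move: (X _ _ _ _) => x /eqP; rewrite addr_eq0 => /eqP H.
apply: (@mulfI _ (sg (mid a) * (q (mid a) bullet / r - 0))).
  by rewrite subr0 !mulf_neq0 ?invr_eq0.
transitivity (sg (mid a) * x * (q (mid a) bullet / r - 0)); first by ring.
by rewrite H; field; rewrite r0 S0.
Qed.

Lemma Rinv_bullet_circ_mid d :
  X bullet circ (mid d) (mid (rev_ord d)) = la * sg (@circ N) * sg (mid d).
Proof.
have := cross bullet (mid (rev_ord d)) (mid d) bullet.
rewrite !index_eqE /= mulr0n.
rewrite (@sum_pair_only2 _ _ _ (mid d) bullet circ (mid (rev_ord d)));
  first last.
- move=> E F N0; move: (mul_neq0r N0); rewrite Rinv_col_mid_bullet.
  case: (E =P mid d) => [->|_] /=.
    case: (rev_ord F =P bullet) => [eF _|_].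
      by left; rewrite -(rev_ordK F) eF rev_bullet.
    by rewrite !index_eqE mulr0n /= mulr0n subr0 eqxx.
  rewrite mulr0n sub0r oppr_eq0; case: (E =P bullet) => [->|_] /=.
    case: (rev_ord F =P mid d) => [eF _|_]; last by rewrite mulr0n eqxx.
    by right; rewrite -(rev_ordK F) eF rev_mid.
  by rewrite mulr0n eqxx.
- by rewrite xpair_eqE !index_eqE.
rewrite rev_circ -[mid (rev_ord d)]rev_mid !rev_ordK rev_mid !Rinv_col_mid_bullet.
rewrite Rinv_col_bullet !index_eqE /= !mulr1n !mulr0n -rev_mid !sg_rev Rmat_diag ?index_eqE //.
rewrite q_bullet_mid q_rev_bullet.
have Q0 := q_neq0 (mid d) bullet.
have S0 := @expfz_neq0 _ s (rho2 (mid d)) s0.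
have S1 := @expfz_neq0 _ s (rho2 (@circ N)) s0.
move: (X _ _ _ _) => x /eqP; rewrite addr_eq0 => /eqP H.
apply: (@mulfI _ ((sg (@circ N))^-1 * (q (mid d) bullet / r - 0))).
  by rewrite subr0 !mulf_neq0 ?invr_eq0.
transitivity ((sg (@circ N))^-1 * x * (q (mid d) bullet / r - 0)); first by ring.
by rewrite H; field; rewrite r0 Q0 S1 S0 oner_neq0.
Qed.

Lemma big_Rmat_row_bullet_circ (G : 'I_N.+2 -> 'I_N.+2 -> K) :
  \sum_E \sum_F R bullet circ E F * G E F =
  r^-1 * G bullet circ + la * (1 - (sg (@circ N)) ^- 2) * G circ bullet
  - la / sg (@circ N) *
    \sum_e (sg (mid e))^-1 * G (mid e) (mid (rev_ord e)).
Proof.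
have pick E F0 x : (forall F, R bullet circ E F = x *+ (F == F0)) ->
    \sum_F R bullet circ E F * G E F = x * G E F0.
  move=> H; rewrite (@sum_only1 _ _ F0) ?H ?eqxx // => F /mul_neq0l.
  by rewrite H; case: (F =P F0) => // _ /=; rewrite eqxx.
rewrite big_index (@pick circ bullet (la * (1 - (sg (@circ N)) ^- 2))); last first.
  by move=> F; rewrite Rmat_row_bullet_circ // !index_eqE.
rewrite (@pick bullet circ r^-1); last first.
  by move=> F; rewrite Rmat_row_bullet_circ // !index_eqE.
rewrite [X in _ + X + _](_ : _ = - (la / sg (@circ N) *
    \sum_e (sg (mid e))^-1 * G (mid e) (mid (rev_ord e)))); first by ring.
rewrite mulr_sumr -sumrN; apply: eq_bigr => e _.
rewrite (@pick _ (mid (rev_ord e)) (- la / sg (@circ N) / sg (mid e))).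
  by rewrite !mulrA !mulNr.
by move=> F; rewrite Rmat_row_bullet_circ // !index_eqE.
Qed.

Hypothesis la0 : la != 0.

(** Row (bullet, circ) of R carries the weights [(sg (mid e))^-1] on the pairs (e, e'), so this row
    of [R * Rinv = 1] evaluates the whole sum without its individual entries. The sum reappears in
    [nu]. *)
Lemma Rinv_twist d :
  \sum_e (sg (mid e))^-1 * X (mid e) (mid (rev_ord e)) (mid d) (mid (rev_ord d))
  = sg (@circ N) ^+ 2 / r * sg (mid d).
Proof.
have := Rmat_Rinv Ru bullet circ (mid d) (mid (rev_ord d)).
rewrite big_Rmat_row_bullet_circ Rinv_bullet_circ_mid Rinv_row_bullet.
rewrite !index_eqE /= !mulr0n mulr0 addr0.
have S1 := @expfz_neq0 _ s (rho2 (@circ N)) s0.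
move: (\sum__ _) => x /eqP; rewrite subr_eq0 eq_sym => /eqP H.
apply: (@mulfI _ (la / sg (@circ N))); first by rewrite mulf_neq0 ?invr_eq0.
by rewrite H; field; rewrite r0 S1.
Qed.

Lemma sum_Rinv_circ_bullet :
  \sum_e (sg (mid e))^-1 * X (mid e) (mid (rev_ord e)) circ bullet =
  sg (@circ N) / la * (r^-1 * X bullet circ circ bullet
    + la * (1 - (sg (@circ N)) ^- 2) * r).
Proof.
have := Rmat_Rinv Ru bullet circ circ bullet.
rewrite big_Rmat_row_bullet_circ Rinv_row_bullet gfac_circ.
rewrite !index_eqE /= invrK mulr1n.
have S1 := @expfz_neq0 _ s (rho2 (@circ N)) s0.
move: (\sum__ _) => x /eqP; rewrite subr_eq0 => /eqP->.
by rewrite !mulrA divfK // mulfV // mul1r.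
Qed.

(* Crossing at (bullet, circ) and the (bullet, circ) row of [R * Rinv = 1] are
   two linear equations for this entry and the sum over the middle indices;
   eliminating the sum spares the evaluation of a geometric series. *)
Lemma Rinv_bullet_circ_corner :
  X bullet circ circ bullet = la * (sg (@circ N) ^+ 2 - 1).
Proof.
have := cross bullet bullet circ bullet.
rewrite !index_eqE /= mulr0n.
under eq_bigr => E _.
  rewrite (@sum_only1 _ _ E); last first.
    by move=> F /mul_neq0r /Rinv_col_circ_bullet_support /rev_ord_inj.
  over.
rewrite /= big_index !index_eqE.
rewrite [X in _ + X + _](_ : _ = - la * \sum_e
    (sg (mid e))^-1 * X (mid e) (mid (rev_ord e)) circ bullet); last first.
  rewrite mulr_sumr; apply: eq_bigr => e _.
  by rewrite Rinv_col_mid_bullet !index_eqE /= mulr0n mulr1n sub0r; ring.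
rewrite sum_Rinv_circ_bullet !Rinv_row_bullet !index_eqE /= mulr1n.
rewrite gfac_bullet gfac_circ sg_bullet !invrK.
have S1 := @expfz_neq0 _ s (rho2 (@circ N)) s0.
rewrite mulNr (mulrA la (_ / la)) (mulrC la (_ / la)) divfK //.
move: (X _ _ _ _) => x H.
apply: (@mulfI _ ((sg (@circ N))^-1 * r)); first by rewrite mulf_neq0 ?invr_eq0.
apply/eqP; rewrite -subr_eq0; apply/eqP; rewrite -{}H.
by field; rewrite r0 S1.
Qed.

End Crossing.
(* Values on the generators of [f_fun] and of its convolution inverse, the
   latter indexed by the transpose. *)
Definition fval B D C E : K := (gfac C)^-1 * X B C D E.
Definition gval B C E F : K := sg E / sg F * fval C B (rev_ord F) (rev_ord E).

End Entries.

(** * Matrix functionals and their left actions *)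

Section Generation.
Context {K : fieldType} {N : nat}.

(** Serves as an induction principle: properties compatible with the algebra operations need
    checking on the entries of T only. *)
Definition generated_by (A : algType K) (T : 'I_N.+2 -> 'I_N.+2 -> A) : Prop :=
  forall a, subalgebra (fun x => exists B C, x = T B C) a.

Lemma free_algebra_image (A : algType K) (p : {lrmorphism free_algebra (K := K) N -> A}) :
  (forall b, exists a, p a = b) -> generated_by (gen_image p).
Proof.
move=> p_surj b; have [a <-] := p_surj b.
rewrite (monalgE a) linear_sum.
elim/big_ind: _ => [|x y|k _]; first by rewrite -(scale0r 1); exact/SubalgZ/Subalg1.
  exact: SubalgD.
have -> : << a@_k *g k >> = a@_k *: << k >>.
  by apply/malgP => k'; rewrite mcoeffZ !mcoeffU mulrnAr mulr1.
rewrite linearZ; apply: SubalgZ; case: k => s.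
elim: s => [|[B C] s IHs].
  have -> : << FMonom [::] >> = 1 :> free_algebra N.
    by rewrite -fmoneE; exact: mpolyC1E.
  by rewrite rmorph1; exact: Subalg1.
have -> : << FMonom ((B, C) :: s) >> = free_gen B C * << FMonom s >> :> free_algebra N.
  symmetry; apply: etrans (malgM_def _ _) _.
  by rewrite fgmulUU mulr1 fmuE; congr << _ >>; exact: fmmulE.
rewrite rmorphM; apply: SubalgM => //.
by apply: SubalgGen; exists B, C.
Qed.

Lemma generated_quotient (A A' : algType K) (T : 'I_N.+2 -> 'I_N.+2 -> A)
    (f : {lrmorphism A -> A'}) :
  (forall b, exists a, f a = b) ->
  generated_by T -> generated_by (fun B C => f (T B C)).
Proof.
move=> f_surj gT b; have [a <-] := f_surj b.
elim: (gT a) => {a b} [_ [B [C ->]]||a b _ IHa _ IHb|k a _ IHa|a b _ IHa _ IHb].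
- by apply: SubalgGen; exists B, C.
- by rewrite rmorph1; exact: Subalg1.
- by rewrite rmorphD; exact: SubalgD.
- by rewrite linearZ; exact: SubalgZ.
by rewrite rmorphM; exact: SubalgM.
Qed.

End Generation.

Section PlainLinear.
Context {K : fieldType} {U V : lmodType K}.

Lemma lin_D (f : U -> V) : linear f -> forall a b, f (a + b) = f a + f b.
Proof. by move=> lf a b; rewrite -[a in LHS]scale1r lf scale1r. Qed.

Lemma lin_0 (f : U -> V) : linear f -> f 0 = 0.
Proof. by move=> lf; apply: (addIr (f 0)); rewrite -lin_D // !add0r. Qed.

Lemma lin_Z (f : U -> V) : linear f -> forall k a, f (k *: a) = k *: f a.
Proof. by move=> lf k a; rewrite -[k *: a in LHS]addr0 lf lin_0 // addr0. Qed.

Lemma lin_sum (f : U -> V) (I : Type) (s : seq I) (F : I -> U) :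
  linear f -> f (\sum_(i <- s) F i) = \sum_(i <- s) f (F i).
Proof.
by move=> lf; elim/big_rec2: _ => [|i x y _ <-]; [exact: lin_0|exact: lin_D].
Qed.

End PlainLinear.

Section MatrixOperators.
Context {K : fieldType} {N : nat}.

(** The rules obeyed by the left actions of a matrix functional; in [operator_gen] the second leg of
    the coproduct of [T E F] has been evaluated. No coproduct is mentioned, so the rules can be
    transported to a quotient whose coproduct depends on representatives. *)
Record is_matrix_operator (A : algType K) (T : 'I_N.+2 -> 'I_N.+2 -> A)
    (O : 'I_N.+2 -> 'I_N.+2 -> A -> A)
    (val : 'I_N.+2 -> 'I_N.+2 -> 'I_N.+2 -> 'I_N.+2 -> K) : Prop := {
  operator_linear : forall B C, linear (O B C);
  operator1 : forall B C, O B C 1 = (B == C)%:R;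
  operatorM : forall B C a b, O B C (a * b) = \sum_E O B E a * O E C b;
  operator_gen : forall B C E F,
    O B C (T E F) = \sum_G val B C G F *: T E G
}.

Section Theory.
Variables (A : algType K) (T : 'I_N.+2 -> 'I_N.+2 -> A).
Hypothesis gT : generated_by T.
Implicit Types O P : 'I_N.+2 -> 'I_N.+2 -> A -> A.

Lemma operator_ext O O' val : is_matrix_operator T O val ->
  is_matrix_operator T O' val -> forall B C a, O B C a = O' B C a.
Proof.
move=> hO hO' B C a; move: B C.
elim: (gT a) => {a} [_ [E [F ->]]||a b _ IHa _ IHb|k a _ IHa|a b _ IHa _ IHb] B C.
- by rewrite (operator_gen hO) (operator_gen hO').
- by rewrite (operator1 hO) (operator1 hO').
- by rewrite !lin_D ?IHa ?IHb //; [case: hO'|case: hO].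
- by rewrite !lin_Z ?IHa //; [case: hO'|case: hO].
rewrite (operatorM hO) (operatorM hO').
by apply: eq_bigr => E _; rewrite IHa IHb.
Qed.

Lemma operator_id :
  is_matrix_operator T (fun B C a => a *+ (B == C))
    (fun B C E F => ((B == C) && (E == F))%:R).
Proof.
split=> [B C k a b|B C|B C a b|B C E F]//.
- by rewrite mulrnDl scalerMnr.
- rewrite (@sum_only1 _ _ B); last first.
    by move=> E; case: (B =P E) => [//|_]; rewrite mulr0n mul0r eqxx.
  by rewrite eqxx mulr1n mulrnAr.
rewrite (@sum_only1 _ _ F); last first.
  by move=> G; case: (G =P F) => [//|_]; rewrite andbF scale0r eqxx.
by rewrite eqxx andbT scaler_nat.
Qed.

(* [P] is indexed by the transpose of the convolution inverse of [O]: the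
   inverse reverses products. *)
Lemma operator_invl O P vO vP :
  is_matrix_operator T O vO -> is_matrix_operator T P vP ->
  (forall B E C J,
     \sum_D \sum_H vP E D C H * vO B D H J = ((B == E) && (C == J))%:R) ->
  forall B E a, \sum_D P E D (O B D a) = a *+ (B == E).
Proof.
move=> hO hP hv B E a; move: B E.
have lO B C : linear (O B C) by case: hO.
have lP B C : linear (P B C) by case: hP.
elim: (gT a) => {a} [_ [G [J ->]]||a b _ IHa _ IHb|k a _ IHa|a b _ IHa _ IHb] B E.
- transitivity (\sum_C (\sum_D \sum_H vP E D C H * vO B D H J) *: T G C).
    under eq_bigr => D _.
      rewrite (operator_gen hO) lin_sum //.
      under eq_bigr => H _ do rewrite lin_Z // (operator_gen hP) scaler_sumr.
      rewrite exchange_big /=.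
      over.
    rewrite exchange_big /=; apply: eq_bigr => C _.
    rewrite scaler_suml; apply: eq_bigr => D _.
    by rewrite scaler_suml; apply: eq_bigr => H _; rewrite scalerA mulrC.
  rewrite (@sum_only1 _ _ J); first by rewrite hv eqxx andbT scaler_nat.
  by move=> C; rewrite hv; case: (C =P J) => // _; rewrite andbF scale0r eqxx.
- rewrite (@sum_only1 _ _ B) => [|D]; rewrite (operator1 hO).
    by rewrite eqxx (operator1 hP) eq_sym.
  by case: (B =P D) => // _; rewrite lin_0 ?eqxx.
- under eq_bigr do rewrite !lin_D //.
  by rewrite big_split /= IHa IHb mulrnDl.
- under eq_bigr do rewrite !lin_Z //.
  by rewrite -scaler_sumr IHa scalerMnr.
transitivity (\sum_H \sum_Q P E Q (O B H a) * (b *+ (H == Q))).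
  under eq_bigr => D _.
    rewrite (operatorM hO) lin_sum //.
    under eq_bigr do rewrite (operatorM hP).
    over.
  rewrite exchange_big; apply: eq_bigr => H _ /=.
  rewrite exchange_big; apply: eq_bigr => Q _ /=.
  by rewrite -IHb mulr_sumr.
under eq_bigr => H _.
  rewrite (@sum_only1 _ _ H); last first.
    by move=> Q; case: (H =P Q) => // _; rewrite mulr0 eqxx.
  rewrite eqxx mulr1n.
  over.
by rewrite /= -mulr_suml IHa mulrnAl.
Qed.

Lemma operator_invr O P vO vP :
  is_matrix_operator T O vO -> is_matrix_operator T P vP ->
  (forall B E C J,
     \sum_D \sum_H vO D E C H * vP D B H J = ((B == E) && (C == J))%:R) ->
  forall B E a, \sum_D O D E (P D B a) = a *+ (B == E).
Proof.
move=> hO hP hv B E a; move: B E.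
have lO B C : linear (O B C) by case: hO.
have lP B C : linear (P B C) by case: hP.
elim: (gT a) => {a} [_ [G [J ->]]||a b _ IHa _ IHb|k a _ IHa|a b _ IHa _ IHb] B E.
- transitivity (\sum_C (\sum_D \sum_H vO D E C H * vP D B H J) *: T G C).
    under eq_bigr => D _.
      rewrite (operator_gen hP) lin_sum //.
      under eq_bigr => H _ do rewrite lin_Z // (operator_gen hO) scaler_sumr.
      rewrite exchange_big /=.
      over.
    rewrite exchange_big /=; apply: eq_bigr => C _.
    rewrite scaler_suml; apply: eq_bigr => D _.
    by rewrite scaler_suml; apply: eq_bigr => H _; rewrite scalerA mulrC.
  rewrite (@sum_only1 _ _ J); first by rewrite hv eqxx andbT scaler_nat.
  by move=> C; rewrite hv; case: (C =P J) => // _; rewrite andbF scale0r eqxx.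
- rewrite (@sum_only1 _ _ B) => [|D]; rewrite (operator1 hP).
    by rewrite eqxx (operator1 hO).
  by case: (D =P B) => // _; rewrite lin_0 ?eqxx.
- under eq_bigr do rewrite !lin_D //.
  by rewrite big_split /= IHa IHb mulrnDl.
- under eq_bigr do rewrite !lin_Z //.
  by rewrite -scaler_sumr IHa scalerMnr.
transitivity (\sum_H \sum_Q (a *+ (H == Q)) * O Q E (P H B b)).
  under eq_bigr => D _.
    rewrite (operatorM hP) lin_sum //.
    under eq_bigr do rewrite (operatorM hO).
    over.
  rewrite exchange_big; apply: eq_bigr => H _ /=.
  rewrite exchange_big; apply: eq_bigr => Q _ /=.
  by rewrite -IHa mulr_suml.
under eq_bigr => H _.
  rewrite (@sum_only1 _ _ H); last first.
    by move=> Q; case: (H =P Q) => // _; rewrite mul0r eqxx.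
  rewrite eqxx mulr1n.
  over.
by rewrite /= -mulr_sumr IHb mulrnAr.
Qed.

End Theory.
End MatrixOperators.

(** * Left actions of matrix functionals *)

Section LeftAction.
Context {K : fieldType} {N : nat} {A : algType K}.
Variables (T : 'I_N.+2 -> 'I_N.+2 -> A) (Delta : A -> seq (A * A)).
Hypotheses (gT : generated_by T) (DeltaP : is_coproduct T Delta).
Implicit Types (phi psi : A -> K) (L : 'I_N.+2 -> 'I_N.+2 -> A -> K).

Lemma tensor_eq_bilinear (V : lmodType K) (beta : A -> A -> V) t t' :
  tensor_eq t t' ->
  (forall a, linear (beta a)) -> (forall b, linear (beta^~ b)) ->
  \sum_(x <- t) beta x.1 x.2 = \sum_(x <- t') beta x.1 x.2.
Proof. by move=> + l1 l2; apply. Qed.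

Section Bilinear.
Variables (V : lmodType K) (beta : A -> A -> V).
Hypotheses (l1 : forall a, linear (beta a)) (l2 : forall b, linear (beta^~ b)).

Lemma bilinear_coproduct_linear k a b :
  \sum_(x <- Delta (k *: a + b)) beta x.1 x.2
  = k *: \sum_(x <- Delta a) beta x.1 x.2 + \sum_(x <- Delta b) beta x.1 x.2.
Proof.
rewrite (tensor_eq_bilinear (coproduct_linear DeltaP k a b)) //.
rewrite big_cat big_map scaler_sumr; congr (_ + _); apply: eq_bigr => x _ /=.
have z0 : beta^~ x.2 0 = 0.
  by have := l2 x.2 (-1) 0 0; rewrite scaler0 addr0 scaleN1r addNr.
by have := l2 x.2 k x.1 0; rewrite /= !addr0 z0 addr0.
Qed.

Lemma bilinear_coproduct1 : \sum_(x <- Delta 1) beta x.1 x.2 = beta 1 1.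
Proof. by rewrite (tensor_eq_bilinear (coproduct1 DeltaP)) // big_seq1. Qed.

Lemma bilinear_coproductM a b : \sum_(x <- Delta (a * b)) beta x.1 x.2 =
  \sum_(x <- Delta a) \sum_(y <- Delta b) beta (x.1 * y.1) (x.2 * y.2).
Proof.
by rewrite (tensor_eq_bilinear (coproductM DeltaP a b)) // big_allpairs_dep.
Qed.

Lemma bilinear_coproduct_gen B C :
  \sum_(x <- Delta (T B C)) beta x.1 x.2 = \sum_E beta (T B E) (T E C).
Proof.
rewrite (tensor_eq_bilinear (coproduct_gen DeltaP B C)) //.
by rewrite big_map big_enum.
Qed.

End Bilinear.

Lemma left_action_linear psi : linear (psi : A -> K^o) ->
  linear (left_action Delta psi).
Proof.
move=> lp k a b.
apply: (bilinear_coproduct_linear (beta := fun a b => psi b *: a)) => c l x y.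
  by rewrite lp scalerDl scalerA.
by rewrite scalerDr !scalerA mulrC.
Qed.

Lemma left_action_operator L val : is_matrix_functional T L val ->
  is_matrix_operator T (fun B C => left_action Delta (L B C)) val.
Proof.
move=> LP; have lL B C : linear (L B C : A -> K^o) by case: LP.
have b1 B C (c : A) : linear (fun b => L B C b *: c).
  by move=> l x y; rewrite lL scalerDl scalerA.
have b2 B C b : linear (fun a : A => L B C b *: a).
  by move=> l x y; rewrite scalerDr !scalerA mulrC.
split=> [B C|B C|B C a b|B C E F].
- exact: left_action_linear.
- rewrite /left_action (bilinear_coproduct1 (beta := fun a b => L B C b *: a)) //.
  by rewrite (functional1 LP) scaler_nat.
- rewrite /left_action (bilinear_coproductM (beta := fun a b => L B C b *: a)) //.
  under eq_bigr do under eq_bigr do rewrite (functionalM LP) scaler_suml.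
  under [in RHS]eq_bigr do rewrite big_distrlr /=.
  rewrite [RHS]exchange_big /=; apply: eq_bigr => x _.
  rewrite [RHS]exchange_big /=; apply: eq_bigr => y _.
  by apply: eq_bigr => E _; rewrite -scalerAl -scalerAr scalerA.
rewrite /left_action (bilinear_coproduct_gen (beta := fun a b => L B C b *: a)) //.
by apply: eq_bigr => G _; rewrite (functional_gen LP).
Qed.

(** Meant for [phi] equal to L^+ bullet bullet composed with the antipode. A character diagonal on T
    only rescales the values, by a factor depending on the upper index. *)
Lemma convolution_character L val (phi : A -> K) (h : 'I_N.+2 -> K) :
  is_matrix_functional T L val ->
  linear (phi : A -> K^o) -> phi 1 = 1 ->
  (forall a b, phi (a * b) = phi a * phi b) ->
  (forall B C, phi (T B C) = h B *+ (B == C)) ->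
  is_matrix_functional T (fun B C => convolution Delta phi (L B C))
    (fun B C E F => h E * val B C E F).
Proof.
move=> LP lphi phi1 phiM phiT.
have lL B C : linear (L B C : A -> K^o) by case: LP.
have b1 B C (a : A) : linear (fun b => phi a * L B C b : K^o).
  by move=> l x y; rewrite lL mulrDr scalerAr.
have b2 B C b : linear (fun a : A => phi a * L B C b : K^o).
  by move=> l x y; rewrite lphi mulrDl scalerAl.
split=> [B C k a b|B C|B C a b|B C E F].
- exact: (bilinear_coproduct_linear (beta := fun a b => phi a * L B C b : K^o)).
- rewrite /convolution (bilinear_coproduct1 (V := K^o) (beta := fun a b => phi a * L B C b)) //.
  by rewrite phi1 mul1r (functional1 LP).
- rewrite /convolution (bilinear_coproductM (V := K^o) (beta := fun a b => phi a * L B C b)) //.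
  under eq_bigr do under eq_bigr do rewrite (functionalM LP) phiM mulr_sumr.
  under [in RHS]eq_bigr do rewrite big_distrlr /=.
  rewrite [RHS]exchange_big /=; apply: eq_bigr => x _.
  rewrite [RHS]exchange_big /=; apply: eq_bigr => y _.
  by apply: eq_bigr => G _; rewrite mulrACA.
rewrite /convolution (bilinear_coproduct_gen (V := K^o) (beta := fun a b => phi a * L B C b)) //.
rewrite (@sum_only1 _ _ E) => [|G].
  by rewrite phiT eqxx (functional_gen LP).
by rewrite phiT; case: (E =P G) => // _; rewrite mul0r eqxx.
Qed.

(** Operators are determined by their values on generators, and those of the counit agree with those
    of the identity. The counit is put on the diagonal of a scalar matrix to make it a matrix
    functional. *)
Lemma left_action_counit (eps : {lrmorphism A -> K^o}) a :
  is_counit T eps -> left_action Delta eps a = a.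
Proof.
move=> epsP.
have LP : is_matrix_functional T (fun B C a => eps a *+ (B == C))
    (fun B C E F => ((B == C) && (E == F))%:R).
  split=> [B C k x y|B C|B C x y|B C E F].
  - by rewrite linearP mulrnDl scalerMnr.
  - by rewrite rmorph1.
  - rewrite (@sum_only1 _ _ B) => [|E].
      by rewrite eqxx rmorphM mulrnAr.
    by case: (B =P E) => // _; rewrite mul0r eqxx.
  by rewrite epsP; case: (B == C); rewrite //= mulr0n.
have := operator_ext gT (left_action_operator LP) (operator_id T) circ circ a.
by rewrite eqxx mulr1n => {2}<-.
Qed.

End LeftAction.

(** * The metric and the defining relations of SO *)

Section Metric.
Context {K : fieldType} {N : nat} (s : K).
Hypothesis s0 : s != 0.
Local Notation sg A := (s ^ (rho2 A)).
Implicit Types A B : 'I_N.+2.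

Lemma metricE A B : metric s A B = (sg A)^-1 *+ (A == rev_ord B).
Proof. by rewrite mxE -invr_expz. Qed.

(** Since rho changes sign under the prime, the metric squares to 1. *)
Lemma metric_invE : metric_inv s = metric s :> 'M_N.+2.
Proof.
suff mm : metric s *m metric s = 1%:M :> 'M_N.+2.
  have [mu _] := mulmx1_unit mm.
  by rewrite /metric_inv -[LHS]mulmx1 -mm mulKmx.
apply/matrixP => A B; rewrite mxE (@sum_only1 _ _ (rev_ord A)) => [|E].
  rewrite !metricE rev_ordK eqxx mulr1n (inj_eq rev_ord_inj) mxE mulrnAr.
  by rewrite sg_rev invrK mulVf ?expfz_neq0.
rewrite metricE; case: (A =P rev_ord E) => [->|_]; first by rewrite rev_ordK.
by rewrite mul0r eqxx.
Qed.

End Metric.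

Lemma relator_ideal (A : pzRingType) (S : A -> Prop) x :
  S x -> two_sided_ideal S x.
Proof. by move=> Sx; rewrite -[x]addr0 -[x]mul1r -[x]mulr1 mulrA; exact/IdealD/Ideal0. Qed.

Section QuadraticRelators.
Context {K : fieldType} {I : finType} {F : lalgType K} {A : algType K}.
Variable p : {lrmorphism F -> A}.
Implicit Types (c : I -> I -> K) (a b : I -> I -> F).

Lemma lrmorphism_quadratic c a b :
  p (\sum_i \sum_j c i j *: (a i j * b i j))
  = \sum_i \sum_j c i j *: (p (a i j) * p (b i j)).
Proof.
rewrite linear_sum; apply: eq_bigr => i _.
rewrite linear_sum; apply: eq_bigr => j _.
by rewrite linearZ rmorphM.
Qed.

Lemma quadratic_relator c a b c' a' b' :
  p (\sum_i \sum_j c i j *: (a i j * b i j)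
     - \sum_i \sum_j c' i j *: (a' i j * b' i j)) = 0 ->
  \sum_i \sum_j c i j *: (p (a i j) * p (b i j))
  = \sum_i \sum_j c' i j *: (p (a' i j) * p (b' i j)).
Proof.
move=> H; rewrite -!lrmorphism_quadratic; apply/eqP.
by rewrite -subr_eq0 -rmorphB; apply/eqP.
Qed.

Lemma constant_relator c a b k :
  p (\sum_i \sum_j c i j *: (a i j * b i j) - k%:A) = 0 ->
  \sum_i \sum_j c i j *: (p (a i j) * p (b i j)) = k%:A.
Proof.
move=> H; rewrite -lrmorphism_quadratic -(rmorph1 p) -linearZ; apply/eqP.
by rewrite -subr_eq0 -linearB; apply/eqP.
Qed.

End QuadraticRelators.

Section SORelations.
Context {K : fieldType} {N : nat} (r s : K) (q : 'I_N.+2 -> 'I_N.+2 -> K).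
Hypothesis s0 : s != 0.
Variables (A : algType K) (p : {lrmorphism free_algebra (K := K) N -> A}).
Hypothesis pP : is_quotient p (so_relator r s q).
Local Notation T := (gen_image p).
Local Notation sg A := (s ^ (rho2 A)).
Implicit Types B C D E F : 'I_N.+2.

Lemma so_relator0 x : so_relator r s q x -> p x = 0.
Proof. by move=> Sx; apply/(proj2 pP)/relator_ideal. Qed.

Lemma so_RTT B C D E :
  \sum_G \sum_F Rmat r s q B C G F *: (T G D * T F E)
  = \sum_G \sum_F Rmat r s q G F D E *: (T C F * T B G).
Proof.
apply: (quadratic_relator (p := p) (a := fun G _ => free_gen G D)
  (b := fun _ F => free_gen F E) (a' := fun _ F => free_gen C F)
  (b' := fun G _ => free_gen B G)).
exact/so_relator0/RelRTT.
Qed.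

Lemma so_metric B D :
  \sum_F (sg F)^-1 *: (T F B * T (rev_ord F) D)
  = ((sg B)^-1 *+ (B == rev_ord D))%:A.
Proof.
rewrite -metricE.
have /so_relator0/(constant_relator (a := fun F _ => free_gen F B)
  (b := fun _ E => free_gen E D)) <- := RelMetric r s q B D.
apply: eq_bigr => F _; rewrite (@sum_only1 _ _ (rev_ord F)) => [|E].
  by rewrite metricE rev_ordK eqxx.
rewrite metricE; case: (F =P rev_ord E) => [->|_].
  by rewrite rev_ordK.
by rewrite scale0r eqxx.
Qed.

Lemma so_metric_inv B D :
  \sum_F (sg F)^-1 *: (T B F * T D (rev_ord F))
  = ((sg B)^-1 *+ (B == rev_ord D))%:A.
Proof.
rewrite -metricE -metric_invE //.
have /so_relator0/(constant_relator (a := fun F _ => free_gen B F)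
  (b := fun _ E => free_gen D E)) <- := RelMetricInv r s q B D.
apply: eq_bigr => F _; rewrite (@sum_only1 _ _ (rev_ord F)) => [|E].
  by rewrite metric_invE // metricE rev_ordK eqxx.
rewrite metric_invE // metricE; case: (F =P rev_ord E) => [->|_].
  by rewrite rev_ordK.
by rewrite scale0r eqxx.
Qed.

(** A functional respects the relations of the algebra; on the metric relation this becomes a
    crossing identity between its values. It is used for L^- and again for f. *)
Lemma functional_metric L val : is_matrix_functional T L val ->
  forall B D E H,
  \sum_G \sum_F (sg F)^-1 * val B G F E * val G D (rev_ord F) H
  = (sg E)^-1 *+ ((B == D) && (E == rev_ord H)).
Proof.
move=> LP B D E H.
have lL G C : linear (L G C : A -> K^o) by case: LP.
have := congr1 (L B D : A -> K^o) (so_metric E H).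
rewrite (lin_sum _ _ (lL B D)) (lin_Z (lL B D)) (functional1 LP).
rewrite -[_ *: _]/(_ * _) mulr_natr -mulrnA mulnb andbC => <-.
rewrite exchange_big; apply: eq_bigr => F _ /=.
rewrite (lin_Z (lL B D)) (functionalM LP) scaler_sumr.
by apply: eq_bigr => G _; rewrite !(functional_gen LP) -mulrA.
Qed.

Lemma functional_metric_inv L val : is_matrix_functional T L val ->
  forall B D E H,
  \sum_G \sum_F (sg F)^-1 * val B G E F * val G D H (rev_ord F)
  = (sg E)^-1 *+ ((B == D) && (E == rev_ord H)).
Proof.
move=> LP B D E H.
have lL G C : linear (L G C : A -> K^o) by case: LP.
have := congr1 (L B D : A -> K^o) (so_metric_inv E H).
rewrite (lin_sum _ _ (lL B D)) (lin_Z (lL B D)) (functional1 LP).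
rewrite -[_ *: _]/(_ * _) mulr_natr -mulrnA mulnb andbC => <-.
rewrite exchange_big; apply: eq_bigr => F _ /=.
rewrite (lin_Z (lL B D)) (functionalM LP) scaler_sumr.
by apply: eq_bigr => G _; rewrite !(functional_gen LP) -mulrA.
Qed.

Section Antipode.
Variable kappa : A -> A.
Hypothesis kappaP : is_antipode T s kappa.

Lemma antipode_genE B C :
  kappa (T B C) = (sg C / sg B) *: T (rev_ord C) (rev_ord B).
Proof.
rewrite (antipode_gen kappaP) (@sum_pair_only1 _ _ _ (rev_ord B) (rev_ord C)).
  by rewrite metric_invE // !metricE !rev_ordK !eqxx sg_rev invrK mulrC.
move=> E F; rewrite metric_invE // !metricE.
case: (B =P rev_ord E) => [->|_]; last by rewrite mul0r scale0r eqxx.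
case: (F =P rev_ord C) => [->|_]; last by rewrite mulr0 scale0r eqxx.
by rewrite rev_ordK.
Qed.

(* The square of the antipode rescales the generators; the weight
   [(sg B / sg C) ^+ 2] replaces [kappa] by its inverse when [val] is of
   weight zero, as in [g_functional]. *)
Lemma antipode_functional L val val' :
  is_matrix_functional T L val ->
  (forall B C E F, (sg B / sg C) ^+ 2 * (sg F / sg E)
     * val C B (rev_ord F) (rev_ord E) = val' B C E F) ->
  is_matrix_functional T
    (fun B C => fun a => (sg B / sg C) ^+ 2 * L C B (kappa a)) val'.
Proof.
move=> LP vv'.
have lL G C : linear (L G C : A -> K^o) by case: LP.
split=> [B C k a b|B C|B C a b|B C E F].
- by rewrite (antipode_linear kappaP) lL /= mulrDr scalerAr.
- rewrite (antipode1 kappaP) (functional1 LP) eq_sym.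
  case: (B =P C) => [->|_]; last by rewrite mulr0.
  by rewrite mulfV ?expfz_neq0 // expr1n mulr1.
- rewrite (antipodeM kappaP) (functionalM LP) mulr_sumr.
  apply: eq_bigr => G _.
  by field; rewrite !expfz_neq0.
by rewrite antipode_genE (lin_Z (lL C B)) (functional_gen LP) mulrA vv'.
Qed.

End Antipode.

(** * The functionals f and their convolution inverse *)

Section Functionals.
Hypotheses (r0 : r != 0) (qP : multiparameters r q).
Variables (Delta : A -> seq (A * A)) (kappa : A -> A).
Variables (Lp Lm : 'I_N.+2 -> 'I_N.+2 -> A -> K).
Hypotheses (gT : generated_by T) (DeltaP : is_coproduct T Delta)
  (kappaP : is_antipode T s kappa)
  (LpP : is_Lplus T r s q Lp) (LmP : is_Lminus T r s q Lm).
Local Notation X := (Rinv r s q).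
Local Notation f := (f_fun Delta kappa Lp Lm).
Local Notation fv := (fval r s q).
Local Notation gv := (gval r s q).

Lemma Lminus_crossing B E D H :
  \sum_G \sum_F (sg F)^-1 * X B F G E * X G (rev_ord F) D H
  = (sg E)^-1 *+ ((B == D) && (E == rev_ord H)).
Proof. exact: (functional_metric LmP). Qed.

(** The values of [Lm] are the entries of [invmx R] whatever R is, so they satisfy crossing. Moving
    the weights to one side, crossing says that [Y] is a left inverse of [invmx R], which is enough
    by [Rmx_unit]. *)
Lemma Rmx_unitmx : Rmx r s q \in unitmx.
Proof.
pose Y B C E F := (sg C)^-1 * sg F * X B (rev_ord F) E (rev_ord C).
apply: (@Rmx_unit _ _ _ _ _ Y) => B C D E.
transitivity ((sg C)^-1 *
    \sum_G \sum_F (sg F)^-1 * X B F G (rev_ord C) * X G (rev_ord F) D E).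
  rewrite mulr_sumr; apply: eq_bigr => G _; rewrite mulr_sumr.
  rewrite (reindex_inj rev_ord_inj); apply: eq_bigr => F _.
  by rewrite /Y rev_ordK sg_rev !mulrA.
rewrite Lminus_crossing sg_rev invrK (inj_eq rev_ord_inj) mulrnAr.
by rewrite mulVf ?expfz_neq0.
Qed.

(** This makes [Lp bullet bullet] multiplicative. The antipode reverses products, but scalars
    commute, so the composite with [kappa] is a character too. *)
Lemma Lplus_row_bullet E a : E != bullet -> Lp bullet E a = 0.
Proof.
have lL G C : linear (Lp G C : A -> K^o) by case: LpP.
move: E; elim: (gT a) => {a} [_ [B [C ->]]||a b _ IHa _ IHb|k a _ IHa|a b _ IHa _ IHb] E nE.
- rewrite (functional_gen LpP); apply/eqP; apply: contraNT nE.
  by move=> /Rmat_row_bullet [_ ->].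
- by rewrite (functional1 LpP) eq_sym (negbTE nE).
- by rewrite (lin_D (lL bullet E)) IHa // IHb // addr0.
- by rewrite (lin_Z (lL bullet E)) IHa // scaler0.
rewrite (functionalM LpP) (@sum_only1 _ _ bullet) ?IHb ?mulr0 // => G.
by have [//|nG] := eqVneq G bullet; rewrite IHa // mul0r eqxx.
Qed.

Lemma f_functional : is_matrix_functional T f fv.
Proof.
have lL G C : linear (Lp G C : A -> K^o) by case: LpP.
apply: (convolution_character DeltaP LmP) => [k a b||a b|B C] /=.
- by rewrite (antipode_linear kappaP) (lL bullet bullet).
- by rewrite (antipode1 kappaP) (functional1 LpP) eqxx.
- rewrite (antipodeM kappaP) (functionalM LpP) (@sum_only1 _ _ bullet).
    by rewrite mulrC.
  move=> G; have [//|nG] := eqVneq G bullet.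
  by rewrite Lplus_row_bullet // mul0r eqxx.
rewrite (antipode_genE kappaP) (lin_Z (lL bullet bullet)) (functional_gen LpP).
have [->|nBC] := eqVneq B C.
  rewrite mulfV ?expfz_neq0 // scale1r mulr1n -(gfac_rev s r0 qP).
  by [].
rewrite mulr0n; set x := Rmat _ _ _ _ _ _ _; suff -> : x = 0 by rewrite scaler0.
apply/eqP; apply: contraNT nBC => /Rmat_row_bullet[/rev_ord_inj -> _].
by [].
Qed.

Lemma g_functional : is_matrix_functional T
  (fun B C => fun a => (sg B / sg C) ^+ 2 * f C B (kappa a)) gv.
Proof.
apply: (antipode_functional kappaP f_functional) => B C E F.
rewrite /gval.
have [->|n0] := eqVneq (fv C B (rev_ord F) (rev_ord E)) 0.
  by rewrite !mulr0.
have := Rinv_sg_weight s0 Rmx_unitmx (mul_neq0r n0); rewrite !sg_rev => H.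
congr (_ * _).
have -> : sg B = sg C / sg F * sg E by rewrite H divfK ?expfz_neq0.
by field; rewrite !expfz_neq0.
Qed.

(** The values [gv] are those of f twisted by the metric, so the two metric relations of T,
    evaluated by f, are the two one-sided inverse identities: this one and [gf_inverse]. *)
Lemma fg_inverse B E C J : \sum_D \sum_H gv E D C H * fv B D H J
  = ((B == E) && (C == J))%:R.
Proof.
transitivity (sg C * (\sum_D \sum_H
   (sg H)^-1 * fv B D H J * fv D E (rev_ord H) (rev_ord C))).
  rewrite mulr_sumr; apply: eq_bigr => D _.
  rewrite mulr_sumr; apply: eq_bigr => H _.
  by rewrite /gval; ring.
rewrite (functional_metric f_functional) rev_ordK eq_sym [J == C]eq_sym.
have [->|_] := eqVneq C J; last by rewrite !andbF mulr0.
by rewrite !andbT mulrnAr mulfV ?expfz_neq0.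
Qed.

Lemma gf_inverse B E C J : \sum_D \sum_H fv D E C H * gv D B H J
  = ((B == E) && (C == J))%:R.
Proof.
transitivity ((sg J)^-1 * (\sum_D \sum_H
   (sg H)^-1 * fv B D (rev_ord J) H * fv D E C (rev_ord H))).
  rewrite mulr_sumr; apply: eq_bigr => D _.
  rewrite mulr_sumr (reindex_inj rev_ord_inj); apply: eq_bigr => H _.
  by rewrite /gval rev_ordK sg_rev; ring.
rewrite (functional_metric_inv f_functional) sg_rev invrK.
rewrite (inj_eq rev_ord_inj) [J == C]eq_sym.
by rewrite mulrnAr mulVf ?expfz_neq0.
Qed.

(* The positions (row, column) of the generators of T killed in ISO. *)
Definition ideal_position C F := (F == circ) && (C != circ) ||
  (C == bullet) && (F != bullet) :> bool.

Lemma fval_ideal_position B D C F : ideal_position C F -> fv B D C F = 0.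
Proof.
rewrite /fval; case/orP => /andP[/eqP-> /negbTE n].
  by rewrite (Rinv_col_circ r0 qP Rmx_unitmx) n andbF mulr0.
by rewrite (Rinv_row_bullet r0 qP Rmx_unitmx) [bullet == _]eq_sym n andbF mulr0.
Qed.

(** The set of killed positions is invariant under (C, F) -> (F', C'), the move made by the antipode
    on generators, so the vanishing of [fv] there carries over. *)
Lemma gval_ideal_position B D C F : ideal_position C F -> gv B D C F = 0.
Proof.
move=> bCF; rewrite /gval fval_ideal_position ?mulr0 //.
move: bCF; rewrite /ideal_position.
rewrite !(can2_eq (@rev_ordK _) (@rev_ordK _)) rev_circ rev_bullet.
by rewrite orbC andbC [X in _ || X]andbC.
Qed.

End Functionals.
End SORelations.

(** * Descent to the inhomogeneous quotient *)

Section Descent.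
Context {K : fieldType} {N : nat} (A A' : algType K).
Variables (T : 'I_N.+2 -> 'I_N.+2 -> A) (pi : {lrmorphism A -> A'}).
Hypothesis piP : is_quotient pi (iso_relator T).
Variable Delta : A -> seq (A * A).
Hypotheses (gT : generated_by T) (DeltaP : is_coproduct T Delta).
Local Notation T' := (fun B C => pi (T B C)).

Lemma iso_gen0 C F : ideal_position C F -> pi (T C F) = 0.
Proof.
move=> bCF; apply/(proj2 piP)/relator_ideal; move: bCF.
case: (indexP C) => [->|[c ->]|->]; case: (indexP F) => [->|[d ->]|->];
  rewrite /ideal_position !index_eqE //= => _; constructor.
Qed.

Lemma iso_relatorP x :
  iso_relator T x -> exists C F, ideal_position C F /\ x = T C F.
Proof.
by case=> [a|b|]; [exists (mid a), circ|exists bullet, (mid b)|exists bullet, circ];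
  rewrite /ideal_position !index_eqE.
Qed.

Lemma ker_ind (P : A -> Prop) : P 0 ->
  (forall C F a b y, ideal_position C F -> P y -> P (a * T C F * b + y)) ->
  forall a, pi a = 0 -> P a.
Proof.
move=> P0 PD a /(proj2 piP); elim=> // {}a x b y Sx _ Py.
by have [C [F [bCF ->]]] := iso_relatorP Sx; apply: PD.
Qed.

(** This is the coideal property of H: if (C, F) is a killed position then, for every J, so is (C,
    J) or (J, F). In the first case [T C J] vanishes in the quotient, in the second the value
    does. *)
Lemma operator_ker O val : is_matrix_operator T O val ->
  (forall B D C F, ideal_position C F -> val B D C F = 0) ->
  forall B D a, pi a = 0 -> pi (O B D a) = 0.
Proof.
move=> OP val0 B D; have lO G C : linear (O G C) by case: OP.
apply: ker_ind; first by rewrite lin_0 ?rmorph0.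
move=> C F a b y bCF IH; rewrite (lin_D (lO B D)) rmorphD /= IH addr0.
rewrite (operatorM OP) rmorph_sum big1 // => E _.
rewrite rmorphM (operatorM OP) rmorph_sum big1 ?mul0r // => G _.
rewrite rmorphM (operator_gen OP) rmorph_sum big1 ?mulr0 // => J _ /=.
rewrite linearZ /=.
have [bCJ|nCJ] := boolP (ideal_position C J); first by rewrite iso_gen0 ?scaler0.
rewrite val0 ?scale0r //; move: nCJ bCF; rewrite /ideal_position.
have [->|[c ->]|->] := indexP C; have [->|[d ->]|->] := indexP F;
  have [->|[e ->]|->] := indexP J; rewrite !index_eqE //=.
Qed.

Lemma representativeE a : pi (representative pi (pi a)) = pi a.
Proof. exact: (@xgetPex _ 0 (fun b => pi b = pi a) (ex_intro _ a (erefl _))). Qed.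

Lemma representative_ker a : pi (representative pi (pi a) - a) = 0.
Proof. by apply/eqP; rewrite rmorphB subr_eq0; apply/eqP/representativeE. Qed.

Section Functional.
Variable phi : A -> K.
Hypotheses (lphi : linear (phi : A -> K^o)).
Hypothesis phi_ker : forall a, pi a = 0 -> phi a = 0.
Hypothesis act_ker : forall a, pi a = 0 -> pi (left_action Delta phi a) = 0.

Lemma induced_functionalE a : induced_functional pi phi (pi a) = phi a.
Proof.
rewrite /induced_functional /= -[representative _ _](subrK a).
by rewrite (lin_D lphi) phi_ker ?representative_ker // add0r.
Qed.

Lemma induced_left_action a :
  left_action (induced_coproduct pi Delta) (induced_functional pi phi) (pi a)
  = pi (left_action Delta phi a).
Proof.
transitivity (pi (left_action Delta phi (representative pi (pi a)))).
  rewrite /left_action big_map linear_sum; apply: eq_bigr => x _.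
  by rewrite induced_functionalE linearZ.
rewrite -[representative _ _](subrK a).
rewrite (lin_D (left_action_linear DeltaP lphi)) rmorphD /=.
by rewrite act_ker ?representative_ker // add0r.
Qed.

End Functional.

Section MatrixFunctional.
Variables (L : 'I_N.+2 -> 'I_N.+2 -> A -> K)
  (val : 'I_N.+2 -> 'I_N.+2 -> 'I_N.+2 -> 'I_N.+2 -> K).
Hypothesis LP : is_matrix_functional T L val.
Hypothesis val0 : forall B D C F, ideal_position C F -> val B D C F = 0.

Let lL B C : linear (L B C : A -> K^o). Proof. by case: LP. Qed.

Lemma functional_ker B D a : pi a = 0 -> L B D a = 0.
Proof.
move: a; apply: ker_ind; first exact: (lin_0 (lL B D)).
move=> C F a b y bCF IH; rewrite (lin_D (lL B D)) IH addr0.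
rewrite (functionalM LP) big1 // => E _.
rewrite (functionalM LP) big1 ?mul0r // => G _.
by rewrite (functional_gen LP) val0 ?mulr0.
Qed.

Lemma left_action_ker B D a : pi a = 0 -> pi (left_action Delta (L B D) a) = 0.
Proof. exact: operator_ker (left_action_operator DeltaP LP) val0 B D a. Qed.

Lemma induced_matrix_action B D a :
  left_action (induced_coproduct pi Delta) (induced_functional pi (L B D)) (pi a)
  = pi (left_action Delta (L B D) a).
Proof.
apply: induced_left_action; first exact: lL.
  exact: functional_ker.
exact: left_action_ker.
Qed.

Lemma induced_operator : is_matrix_operator T'
  (fun B D => left_action (induced_coproduct pi Delta)
                          (induced_functional pi (L B D))) val.
Proof.
have OP := left_action_operator DeltaP LP.
have lO G C : linear (left_action Delta (L G C)) by case: OP.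
split=> [B C k a b|B C|B C a b|B C E F].
- have [[a' <-] [b' <-]] := (proj1 piP a, proj1 piP b).
  by rewrite -linearP !induced_matrix_action lO linearP.
- rewrite -(rmorph1 pi) induced_matrix_action (operator1 OP).
  by rewrite rmorphMn.
- have [[a' <-] [b' <-]] := (proj1 piP a, proj1 piP b).
  rewrite -rmorphM induced_matrix_action (operatorM OP) rmorph_sum.
  by apply: eq_bigr => E _; rewrite !induced_matrix_action rmorphM.
rewrite induced_matrix_action (operator_gen OP) rmorph_sum.
by apply: eq_bigr => G _; rewrite /= linearZ.
Qed.

(* Since [chi] is [f bullet] minus the counit, the differential is the inner
   derivation given by the basis form of index [bullet]. *)
Lemma induced_chi (r : K) (eps : {lrmorphism A -> K^o}) B a :
  is_counit T eps ->
  left_action (induced_coproduct pi Delta)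
    (induced_functional pi (chi_fun r eps L B)) a
  = (r - r^-1)^-1 *: (left_action (induced_coproduct pi Delta)
       (induced_functional pi (L bullet B)) a - a *+ (bullet == B)).
Proof.
move=> epsP; have [{}a <-] := proj1 piP a.
have chi_act b : left_action Delta (chi_fun r eps L B) b
    = (r - r^-1)^-1 *: (left_action Delta (L bullet B) b - b *+ (bullet == B)).
  rewrite -[in b *+ _](left_action_counit gT DeltaP b epsP) /left_action.
  rewrite -sumrMnl -sumrB scaler_sumr; apply: eq_bigr => x _.
  by rewrite scalerMnl -scalerBl scalerA /chi_fun mulr_natl.
have eps_ker b : pi b = 0 -> eps b = 0.
  move: b; apply: ker_ind; first exact: rmorph0.
  move=> C F b c y bCF IH; rewrite rmorphD /= IH addr0 !rmorphM /= epsP.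
  case: eqP bCF => [->|_ _]; last by rewrite mulr0 mul0r.
  by rewrite /ideal_position !andbN.
rewrite (induced_left_action (phi := chi_fun r eps L B)).
- by rewrite chi_act linearZ linearB rmorphMn /= -induced_matrix_action.
- move=> k x y; rewrite /chi_fun (lL bullet B) linearP.
  by rewrite -![_ *: _]/(_ * _); ring.
- by move=> b b0; rewrite /chi_fun functional_ker // eps_ker // !mulr0 subr0 mulr0.
move=> b b0; rewrite chi_act linearZ linearB rmorphMn /= left_action_ker // b0.
by rewrite mul0rn subr0 scaler0.
Qed.

End MatrixFunctional.
End Descent.

(** * Spans and free generation *)

Section Spans.
Context {A : nzRingType} {V : zmodType}.

(* A module over [A] or over its opposite, according to [mul]. *)
Record is_action (mul : A -> A -> A) (act : A -> V -> V) : Prop := {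
  actDl : forall a b w, act (a + b) w = act a w + act b w;
  actDr : forall a w w', act a (w + w') = act a w + act a w';
  actM : forall a b w, act a (act b w) = act (mul a b) w;
  act1 : forall w, act 1 w = w
}.

Record is_subring_for (mul : A -> A -> A) (M : A -> Prop) : Prop := {
  subring0 : M 0;
  subring1 : M 1;
  subringN : forall a, M a -> M (- a);
  subringD : forall a b, M a -> M b -> M (a + b);
  subringM : forall a b, M a -> M b -> M (mul a b)
}.

Definition in_span (act : A -> V -> V) (M : A -> Prop) (I : finType)
    (e : I -> V) (w : V) : Prop :=
  exists c : {ffun I -> A}, (forall i, M (c i)) /\ w = \sum_i act (c i) (e i).

(** The coefficients range over all of A, so independence can be drawn from the invertibility of T,
    whose entries are not all in M. *)
Definition independent (act : A -> V -> V) (I : finType) (e : I -> V) : Prop :=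
  forall c : I -> A, \sum_i act (c i) (e i) = 0 -> forall i, c i = 0.

Section Action.
Variables (mul : A -> A -> A) (act : A -> V -> V) (M : A -> Prop).
Hypotheses (actP : is_action mul act) (MP : is_subring_for mul M).

Lemma act0l w : act 0 w = 0.
Proof. by apply: (addIr (act 0 w)); rewrite -(actDl actP) !add0r. Qed.

Lemma act0r a : act a 0 = 0.
Proof. by apply: (addIr (act a 0)); rewrite -(actDr actP) !add0r. Qed.

Lemma actN a w : act (- a) w = - act a w.
Proof. by apply: (addIr (act a w)); rewrite -(actDl actP) !addNr act0l. Qed.

Lemma act_sum a (I : Type) (t : seq I) (F : I -> V) :
  act a (\sum_(i <- t) F i) = \sum_(i <- t) act a (F i).
Proof. by elim/big_rec2: _ => [|i x y _ <-]; [exact: act0r|rewrite (actDr actP)]. Qed.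

Section Family.
Variables (I : finType) (e : I -> V).

Lemma span_submodule : is_submodule act M (in_span act M e).
Proof.
split=> [|w w' [c [Mc ->]] [c' [Mc' ->]]|m w Mm [c [Mc ->]]].
- exists [ffun=> 0]; split=> [i|]; first by rewrite ffunE; exact: subring0 MP.
  by rewrite big1 // => i _; rewrite ffunE act0l.
- exists [ffun i => c i + c' i]; split=> [i|].
    by rewrite ffunE; exact: (subringD MP).
  by rewrite -big_split; apply: eq_bigr => i _; rewrite ffunE (actDl actP).
exists [ffun i => mul m (c i)]; split=> [i|].
  by rewrite ffunE; exact: (subringM MP).
by rewrite act_sum; apply: eq_bigr => i _; rewrite ffunE (actM actP).
Qed.

Lemma mem_span i : in_span act M e (e i).
Proof.
exists [ffun j => if j == i then 1 else 0]; split=> [j|].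
  by rewrite ffunE; case: ifP => _; [exact: subring1 MP|exact: subring0 MP].
rewrite (bigD1 i) //= ffunE eqxx (act1 actP) big1 ?addr0 // => j /negbTE nj.
by rewrite ffunE nj act0l.
Qed.

Lemma submodule_sum (G : V -> Prop) (J : Type) (t : seq J) (F : J -> V) :
  is_submodule act M G -> (forall j, G (F j)) -> G (\sum_(j <- t) F j).
Proof.
move=> GP GF; elim/big_ind: _ => //; first exact: submodule0 GP.
exact: (submoduleD GP).
Qed.

Lemma span_min (G : V -> Prop) : is_submodule act M G ->
  (forall i, G (e i)) -> forall w, in_span act M e w -> G w.
Proof.
move=> GP Ge w [c [Mc ->]]; apply: submodule_sum => // i.
exact: (submoduleZ GP).
Qed.

Lemma freely_generated_intro (G : V -> Prop) : is_submodule act M G ->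
  (forall i, G (e i)) -> (forall w, G w -> in_span act M e w) ->
  independent act e -> freely_generated act M G e.
Proof.
move=> GP Ge Gs ie; split=> // w Gw.
have [c [Mc ew]] := Gs w Gw; exists c; split=> // c' [_ ew'].
apply/ffunP => i; apply/eqP; rewrite -subr_eq0; apply/eqP.
apply: (ie (fun i => c i - c' i)) => {i}.
under eq_bigr do rewrite (actDl actP) actN.
by rewrite sumrB -ew -ew' subrr.
Qed.

End Family.

(** One basis vector is replaced, with an invertible coefficient [m] at its own place. The product
    is a variable [mul], with its laws as hypotheses, so that the same statement covers left and
    right modules. *)
Lemma freely_generated_change (I : finType) (G : V -> Prop) (e e' : I -> V)
    (i0 i1 : I) (m m' n : A) :
  i0 != i1 -> M m' -> M n -> mul m' m = 1 -> mul m m' = 1 ->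
  (forall a b c, mul a (mul b c) = mul (mul a b) c) ->
  (forall a, mul a 1 = a) -> (forall a, mul 0 a = 0) ->
  (forall i, i != i0 -> e' i = e i) ->
  e' i0 = act m (e i0) + act n (e i1) -> G (e' i0) ->
  freely_generated act M G e -> independent act e ->
  freely_generated act M G e' /\ independent act e'.
Proof.
move=> n01 Mm' Mn m'm mm' mulA mul1r' mul0r' ee' e0 Ge0 [GP Ge Gc] ie.
have n10 : i1 != i0 by rewrite eq_sym.
have ie' : independent act e'.
  move=> c c0.
  (* A relation between the [e'] rewritten in the old family: [e' i0] contributes to both [i0] and
     [i1]. *)
  have H : \sum_i act (if i == i0 then mul (c i0) m
      else if i == i1 then c i1 + mul (c i0) n else c i) (e i) = 0.
    rewrite -[RHS]c0 (bigD1 i0) //= (bigD1 i1) //= eqxx (negbTE n10) eqxx.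
    rewrite [RHS](bigD1 i0) //= [X in _ = _ + X](bigD1 i1) //= e0 (actDr actP) !(actM actP).
    rewrite ee' // (actDl actP) -!addrA; congr (_ + _).
    rewrite addrCA; congr (_ + (_ + _)); apply: eq_bigr => i /andP[n0 n1].
    by rewrite (negbTE n0) (negbTE n1) ee'.
  have ci := ie _ H.
  have c00 : c i0 = 0.
    by have := ci i0; rewrite eqxx => c0m; rewrite -(mul1r' (c i0)) -mm' mulA c0m mul0r'.
  move=> i; have := ci i; case: ifP => [/eqP->//|_].
  by case: ifP => [/eqP->|//]; rewrite c00 mul0r' addr0.
split=> //; apply: freely_generated_intro => // [i|w Gw].
  by have [->//|ni] := eqVneq i i0; rewrite ee'.
have sp := span_submodule e'.
have [c [[Mc ->] _]] := Gc w Gw.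
apply: submodule_sum => // i; apply: (submoduleZ sp) => //.
have [->|ni] := eqVneq i i0; last by rewrite -ee' //; exact: mem_span.
have -> : e i0 = act m' (e' i0 + act (- n) (e' i1)).
  by rewrite (ee' i1) // actN e0 addrK (actM actP) m'm (act1 actP).
apply: (submoduleZ sp) => //; apply: (submoduleD sp); first exact: mem_span.
by apply: (submoduleZ sp); [exact: subringN MP _ Mn|exact: mem_span].
Qed.

End Action.

End Spans.

Section StableSpan.
Context {K : fieldType} {A : algType K} {V : zmodType}.

Lemma subalgebra_scalar (S : A -> Prop) k : subalgebra S k%:A.
Proof. exact/SubalgZ/Subalg1. Qed.

Lemma subalgebra_subring (mul : A -> A -> A) (S : A -> Prop) :
  (forall a b, mul a b = a * b) \/ (forall a b, mul a b = b * a) ->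
  is_subring_for mul (subalgebra S).
Proof.
move=> mulE; split.
- by rewrite -(scale0r 1); exact: subalgebra_scalar.
- exact: Subalg1.
- by move=> a Ma; rewrite -scaleN1r; exact: SubalgZ.
- by move=> a b; exact: SubalgD.
by move=> a b Ma Mb; case: mulE => ->; exact: SubalgM.
Qed.

(** The elements whose action from the other side preserves the span form a subalgebra, and the two
    actions commute. Only generators of M acting on the family need checking. *)
Lemma span_stable (mul mul' : A -> A -> A) (act act' : A -> V -> V)
    (S : A -> Prop) (I : finType) (e : I -> V) :
  is_action mul act -> is_action mul' act' ->
  (forall a b, mul a b = a * b) \/ (forall a b, mul a b = b * a) ->
  (forall a b, mul' a b = a * b) \/ (forall a b, mul' a b = b * a) ->
  (forall a b w, act' a (act b w) = act b (act' a w)) ->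
  (forall k a w, act' (k *: a) w = act k%:A (act' a w)) ->
  (forall y i, S y -> in_span act (subalgebra S) e (act' y (e i))) ->
  forall m w, subalgebra S m -> in_span act (subalgebra S) e w ->
    in_span act (subalgebra S) e (act' m w).
Proof.
move=> actP act'P mulE mul'E actC actZ gen m w Mm; move: w.
have MP := subalgebra_subring S mulE.
have sp := span_submodule actP MP e.
elim: Mm => {m} [y Sy||a b _ IHa _ IHb|k a _ IHa|a b _ IHa _ IHb] w ww.
- apply: (span_min (G := fun w => in_span act _ e (act' y w))) ww.
    split=> [|w1 w2 h1 h2|c w1 Mc h1].
    + by rewrite (act0r act'P); exact: submodule0 sp.
    + by rewrite (actDr act'P); exact: (submoduleD sp).
    by rewrite actC; exact: (submoduleZ sp).
  by move=> i; exact: gen.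
- by rewrite (act1 act'P).
- by rewrite (actDl act'P); apply: (submoduleD sp); [exact: IHa|exact: IHb].
- by rewrite actZ; apply: (submoduleZ sp); [exact: subalgebra_scalar|exact: IHa].
(* For the opposite product the two factors act in the reverse order. *)
case: mul'E => mul'E; rewrite -mul'E -(actM act'P).
  exact/IHa/IHb.
exact/IHb/IHa.
Qed.

End StableSpan.

(** * The bimodule of one-forms *)

Section Inhomogeneous.
Context {K : fieldType} {N : nat} (r s : K) (q : 'I_N.+2 -> 'I_N.+2 -> K).
Local Notation R := (Rmat r s q).
Local Notation X := (Rinv r s q).
Local Notation la := (r - r^-1).
Local Notation sg A := (s ^ (rho2 A)).
Local Notation sgc := (s ^ (rho2 (@circ N))).
Local Notation qb b := (q (mid b) bullet).
Hypotheses (r0 : r != 0) (s0 : s != 0) (qP : multiparameters r q) (la0 : la != 0).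
Hypothesis cross : forall A B D H : 'I_N.+2,
  \sum_E \sum_F (sg F)^-1 * X A F E B * X E (rev_ord F) D H
  = (sg B)^-1 *+ ((A == D) && (B == rev_ord H)).
Hypothesis Ru : Rmx r s q \in unitmx.

Variables (A : algType K) (T : 'I_N.+2 -> 'I_N.+2 -> A).
Hypothesis T0 : forall C F, ideal_position C F -> T C F = 0.
Hypothesis RTT : forall B C D E,
  \sum_G \sum_F R B C G F *: (T G D * T F E)
  = \sum_G \sum_F R G F D E *: (T C F * T B G).
Hypothesis TCT : forall B D, \sum_F (sg F)^-1 *: (T F B * T (rev_ord F) D)
  = ((sg B)^-1 *+ (B == rev_ord D))%:A.
Hypothesis TTC : forall B D, \sum_F (sg F)^-1 *: (T B F * T D (rev_ord F))
  = ((sg B)^-1 *+ (B == rev_ord D))%:A.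

Local Notation x a := (T (mid a) bullet).
Local Notation u := (T circ circ).
Local Notation v := (T bullet bullet).
Local Notation z := (T circ bullet).

Let S0 (B : 'I_N.+2) : sg B != 0. Proof. exact: expfz_neq0. Qed.
Let Q0 b : qb b != 0. Proof. exact: qparam_neq0 qP _ _. Qed.

(** * Relations among the generators of ISO *)

Lemma T_mid_circ a : T (mid a) circ = 0.
Proof. by rewrite T0 // /ideal_position !index_eqE. Qed.

Lemma T_bullet_mid a : T bullet (mid a) = 0.
Proof. by rewrite T0 // /ideal_position !index_eqE. Qed.

Lemma T_bullet_circ : T bullet circ = 0.
Proof. by rewrite T0 // /ideal_position !index_eqE. Qed.

Definition T_zero := (T_mid_circ, T_bullet_mid, T_bullet_circ).

Lemma mul_uv : u * v = 1.
Proof.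
have := TTC circ bullet; rewrite big_index !index_eqE mulr1n !T_zero.
rewrite big1 => [|b _]; last by rewrite index_eqE T_zero mulr0 scaler0.
rewrite mulr0 scaler0 !addr0 => /(congr1 ( *:%R sgc)).
by rewrite !scalerA mulfV // !scale1r.
Qed.

Lemma mul_vu : v * u = 1.
Proof.
have := TTC bullet circ; rewrite big_index !index_eqE mulr1n !T_zero.
rewrite big1 => [|b _]; last by rewrite index_eqE T_zero mul0r scaler0.
rewrite mul0r scaler0 !add0r => /(congr1 ( *:%R (sg (@bullet N)))).
by rewrite !scalerA mulfV // !scale1r.
Qed.

Lemma T_mid_metric a d :
  \sum_b (sg (mid b))^-1 *: (T (mid a) (mid b) * T (mid d) (mid (rev_ord b)))
  = ((sg (mid a))^-1 *+ (a == rev_ord d))%:A.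
Proof.
have := TTC (mid a) (mid d); rewrite big_index !index_eqE !T_zero.
rewrite mul0r mulr0 !scaler0 addr0 add0r => <-.
by apply: eq_bigr => b _; rewrite index_eqE.
Qed.

(** The metric relation at (bullet, mid b) isolates [v * T circ (mid b)]; at (mid b, bullet), in the
    next lemma, it isolates the product in the other order. The two forms serve the left and the
    right expansion of [tau circ]. *)
Lemma T_circ_mid_left b : T circ (mid b) = - (sgc^-1 *:
  (u * \sum_a (sg (mid a))^-1 *: (x a * T (mid (rev_ord a)) (mid b)))).
Proof.
have := TCT bullet (mid b); rewrite big_index !index_eqE !T_zero.
rewrite mulr0 scaler0 add0r mulr0n scale0r.
under eq_bigr do rewrite index_eqE.
move/eqP; rewrite addr_eq0 => /eqP ->.
rewrite sg_bullet invrK mulrN scalerN opprK -scalerAr scalerA mulVf // scale1r.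
by rewrite mulrA mul_uv mul1r.
Qed.

Lemma T_circ_mid_right b : T circ (mid b) = - (sgc *:
  ((\sum_a (sg (mid a))^-1 *: (T (mid a) (mid b) * x (rev_ord a))) * u)).
Proof.
have := TCT (mid b) bullet; rewrite big_index !index_eqE !T_zero.
rewrite mul0r scaler0 addr0 mulr0n scale0r.
under eq_bigr do rewrite index_eqE.
move/eqP; rewrite addrC addr_eq0 => /eqP ->.
rewrite mulNr scalerN opprK -scalerAl scalerA mulfV // scale1r.
by rewrite -mulrA mul_vu mulr1.
Qed.

Lemma mul_zv : z * v = r ^+ 2 *: (v * z).
Proof.
have := RTT circ bullet bullet bullet.
rewrite (@sum_pair_only1 _ _ _ circ bullet); last first.
  move=> E F; have [->|/Rmat_row_circ //] := eqVneq (R circ bullet E F) 0.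
  by rewrite scale0r eqxx.
rewrite (@sum_pair_only1 _ _ _ bullet bullet); last first.
  move=> E F; have [->|/Rmat_col_bullet //] := eqVneq (R E F bullet bullet) 0.
  by rewrite scale0r eqxx.
rewrite Rmat_bullet2 Rmat_circ_bullet => /(congr1 ( *:%R r)).
by rewrite !scalerA mulfV // scale1r.
Qed.

(** The metric relation at (bullet, bullet) is L plus multiples of z v and v z, merged by [mul_zv].
    As [sgc] is r^(N/2), the constant is r^(2-N/2) + r^(N/2). *)
Lemma quad_LE : quad_L T s = - ((sgc^-1 * r ^+ 2 + sgc) *: (v * z)).
Proof.
have := TCT bullet bullet; rewrite big_index !index_eqE mulr0n scale0r.
rewrite mul_zv sg_bullet invrK !scalerA => /eqP.
rewrite addrAC -scalerDl addrC addr_eq0 => /eqP <-.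
apply: eq_bigr => e _; rewrite (@sum_only1 _ _ (rev_ord e)) => [|f].
  by rewrite metricE !index_eqE rev_ordK eqxx.
rewrite metricE !index_eqE; case: (e =P _) => [->|_]; first by rewrite rev_ordK.
by rewrite scale0r eqxx.
Qed.

Lemma mul_Tv a c : T (mid a) (mid c) * v = (qb a / qb c) *: (v * T (mid a) (mid c)).
Proof.
have := RTT (mid a) bullet (mid c) bullet.
rewrite (@sum_pair_only1 _ _ _ (mid a) bullet); last first.
  move=> E F; have [->|/Rmat_row_bullet //] := eqVneq (R (mid a) bullet E F) 0.
  by rewrite scale0r eqxx.
rewrite (@sum_pair_only2 _ _ _ (mid c) bullet bullet (mid c)); first last.
- move=> E F; have [->|/Rmat_col_mid_bullet //] := eqVneq (R E F (mid c) bullet) 0.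
  by rewrite scale0r eqxx.
- by rewrite xpair_eqE !index_eqE.
rewrite T_zero mul0r scaler0 addr0 -/(gfac _ _ _ _) -/(gfac _ _ _ (mid c)) !gfac_mid.
move/(congr1 ( *:%R (qb a / r))); rewrite !scalerA.
have -> : qb a / r * (r / qb a) = 1 by field; rewrite r0 Q0.
rewrite scale1r => ->; congr (_ *: _); by field; rewrite r0 Q0.
Qed.

Lemma mul_Tx a c d : T (mid a) (mid c) * x d = (r / qb c) *:
  \sum_e \sum_f R (mid d) (mid a) (mid e) (mid f) *: (x e * T (mid f) (mid c)).
Proof.
have := RTT (mid d) (mid a) bullet (mid c).
rewrite [RHS](@sum_pair_only1 _ _ _ bullet (mid c)); last first.
  move=> E F; have [->|/Rmat_col_bullet //] := eqVneq (R E F bullet (mid c)) 0.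
  by rewrite scale0r eqxx.
rewrite Rmat_diag ?index_eqE // (q_bullet_mid qP).
move=> H; rewrite -[LHS]scale1r.
have -> : 1 = (r / qb c) * (r / (r ^+ 2 / qb c)) by field; rewrite r0 Q0.
rewrite -[LHS]scalerA -{}H; congr (_ *: _).
(* Terms with an extreme summation index drop out, by the support of R or because an entry of T
   vanishes; the R-matrix on the middle indices remains. *)
have z0 E F : (E \notin codom (@mid N)) || (F \notin codom (@mid N)) ->
    R (mid d) (mid a) E F *: (T E bullet * T F (mid c)) = 0.
  move=> nEF; have [->|n0] := eqVneq (R (mid d) (mid a) E F) 0; first by rewrite scale0r.
  case: (indexP F) => [eF|[f eF]|->]; last by rewrite T_zero mulr0 scaler0.
    by move: n0; rewrite eF => /Rmat_col_circ [_ /eqP]; rewrite index_eqE.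
  case: (indexP E) => [eE|[e eE]|eE].
  - move: n0; rewrite eE eF => /Rmat_col_circ_mid[] [/eqP + /eqP];
    by rewrite !index_eqE.
  - by move: nEF; rewrite eE eF !codom_f.
  by move: n0; rewrite eE => /Rmat_col_bullet [/eqP]; rewrite index_eqE.
have nc : @circ N \notin codom (@mid N) by apply/codomP => -[f /eqP]; rewrite index_eqE.
have nb : @bullet N \notin codom (@mid N) by apply/codomP => -[f /eqP]; rewrite index_eqE.
rewrite big_index big1 => [|F _]; last by rewrite z0 ?nc.
rewrite [X in _ + X]big1 => [|F _]; last by rewrite z0 ?nb.
rewrite addr0 add0r; apply: eq_bigr => e _.
by rewrite big_index z0 ?nc ?orbT // add0r z0 ?nb ?orbT // addr0.
Qed.


(** * Right multiplication of forms *)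

Variables F G : 'I_N.+2 -> 'I_N.+2 -> A -> A.
Hypotheses (FP : is_matrix_operator T F (fval r s q))
  (GP : is_matrix_operator T G (gval r s q)).
Hypothesis FG : forall B E a, \sum_D F D E (G D B a) = a *+ (B == E).
Hypothesis GF : forall B E a, \sum_D G E D (F B D a) = a *+ (B == E).

Local Notation forms := (forms N A).
Implicit Types (w : forms) (k : K).

Definition ract a w : forms := \row_D \sum_B w 0 B * F B D a.
Definition omega (B : 'I_N.+2) : forms := delta_mx 0 B.

Let lF B C : linear (F B C). Proof. by case: FP. Qed.
Let lG B C : linear (G B C). Proof. by case: GP. Qed.

Lemma formP w w' : (forall D, w 0 D = w' 0 D) -> w = w'.
Proof. by move=> H; apply/rowP. Qed.

Lemma form_sum w : w = \sum_B w 0 B *: omega B.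
Proof. exact: row_sum_delta. Qed.

Lemma ractDr a w w' : ract a (w + w') = ract a w + ract a w'.
Proof.
apply: formP => D; rewrite !mxE -big_split; apply: eq_bigr => B _.
by rewrite mxE mulrDl.
Qed.

Lemma ractDl a b w : ract (a + b) w = ract a w + ract b w.
Proof.
apply: formP => D; rewrite !mxE -big_split; apply: eq_bigr => B _.
by rewrite (lin_D (lF B D)) mulrDr.
Qed.

Lemma ractM a b w : ract b (ract a w) = ract (a * b) w.
Proof.
apply: formP => D; rewrite !mxE.
under eq_bigr do rewrite mxE mulr_suml.
rewrite exchange_big; apply: eq_bigr => B _ /=.
by rewrite (operatorM FP) mulr_sumr; apply: eq_bigr => E _; rewrite mulrA.
Qed.

Lemma ract1 w : ract 1 w = w.
Proof.
apply: formP => D; rewrite mxE (@sum_only1 _ _ D) => [|B].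
  by rewrite (operator1 FP) eqxx mulr1.
by rewrite (operator1 FP); case: (B =P D) => // _; rewrite mulr0 eqxx.
Qed.

Lemma ract_lmul a c w : ract a (c *: w) = c *: ract a w.
Proof.
apply: formP => D; rewrite !mxE mulr_sumr.
by apply: eq_bigr => B _; rewrite mxE mulrA.
Qed.

Lemma ractZ k a w : ract (k *: a) w = k%:A *: ract a w.
Proof.
apply: formP => D; rewrite !mxE mulr_sumr; apply: eq_bigr => B _.
by rewrite (lin_Z (lF B D)) -scalerAr -scalerAl mul1r.
Qed.

Lemma ract0l w : ract 0 w = 0.
Proof. by rewrite -(scale0r 0) ractZ !scale0r. Qed.

Lemma ract0r a : ract a 0 = 0.
Proof. by rewrite -(scale0r 0) ract_lmul !scale0r. Qed.

Lemma ract_sum a (I : Type) (t : seq I) (P : I -> forms) :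
  ract a (\sum_(i <- t) P i) = \sum_(i <- t) ract a (P i).
Proof. by elim/big_rec2: _ => [|i y y' _ <-]; [exact: ract0r|rewrite ractDr]. Qed.

Lemma ract_omega a B : ract a (omega B) = \sum_D F B D a *: omega D.
Proof.
rewrite [LHS]form_sum; apply: eq_bigr => D _; congr (_ *: _).
rewrite mxE (@sum_only1 _ _ B) => [|E]; rewrite mxE ?eqxx ?mul1r //=.
by case: (E =P B) => // _; rewrite mul0r eqxx.
Qed.

Lemma lmul_omega a B : a *: omega B = \sum_D ract (G D B a) (omega D).
Proof.
under eq_bigr do rewrite ract_omega.
rewrite exchange_big /= (@sum_only1 _ _ B) => [|E]; rewrite -scaler_suml FG ?eqxx //.
by case: (B =P E) => // _; rewrite scale0r eqxx.
Qed.

(** The relation means that [\sum_B F B D (c B)] vanishes for every D; applying [G E D] and summing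
    over D recovers [c E]. *)
Lemma ract_omega_indep (c : 'I_N.+2 -> A) :
  \sum_B ract (c B) (omega B) = 0 -> forall B, c B = 0.
Proof.
move=> c0 E.
have cD D : \sum_B F B D (c B) = 0.
  have /rowP/(_ D) := c0; rewrite mxE => H; rewrite -[RHS]H summxE.
  apply: eq_bigr => B _; rewrite ract_omega summxE (@sum_only1 _ _ D) => [|J].
    by rewrite !mxE !eqxx mulr1.
  by rewrite !mxE eqxx [D == J]eq_sym /=; case: (J =P D) => // _; rewrite mulr0 eqxx.
have := GF E E (c E); rewrite eqxx mulr1n => <-.
transitivity (\sum_B \sum_D G E D (F B D (c B))).
  rewrite [RHS](@sum_only1 _ _ E) // => B; rewrite GF.
  by case: (B =P E) => // _; rewrite eqxx.
rewrite exchange_big big1 // => D _ /=.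
by rewrite -(lin_sum _ _ (lG E D)) cD (lin_0 (lG E D)).
Qed.

Lemma scale_kA k a w : (k *: a) *: w = k%:A *: (a *: w).
Proof. by rewrite scalerA -scalerAl mul1r. Qed.

Lemma lmul_kA k a w : a *: (k%:A *: w) = k%:A *: (a *: w).
Proof. by rewrite !scalerA -scalerAl -scalerAr mul1r mulr1. Qed.

Lemma scale_kAA k k' w : k%:A *: (k'%:A *: w) = ((k * k')%:A : A) *: w.
Proof. by rewrite -scale_kA scalerA. Qed.

(** * Moving the distinguished forms past the plane *)

Local Notation wb := (omega bullet).
Local Notation oc := (omega circ).

(* For [C = mid a] this is [eta^a]; [tau circ] enters dz. *)
Definition tau (C : 'I_N.+2) : forms :=
  \sum_b ((qb b / r) *: T C (mid b)) *: omega (mid b).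

Lemma F_bullet_bullet C : F bullet bullet (T C bullet) = r ^- 2 *: T C bullet.
Proof.
rewrite (operator_gen FP) (@sum_only1 _ _ bullet) => [|H].
  by rewrite /fval Rinv_col_bullet // gfac_bullet Rmat_bullet2 !eqxx mulr1n -invfM.
rewrite /fval Rinv_col_bullet // eqxx /=; case: (H =P _) => // _.
by rewrite mulr0 scale0r eqxx.
Qed.

Lemma F_bullet_mid C d :
  F bullet (mid d) (T C bullet) = - la *: ((qb d / r) *: T C (mid d)).
Proof.
rewrite (operator_gen FP) (@sum_only1 _ _ (mid d)) => [|H].
  rewrite /fval Rinv_col_mid_bullet // gfac_mid !index_eqE /= mulr0n mulr1n sub0r.
  by rewrite scalerA invf_div mulrC.
rewrite /fval Rinv_col_mid_bullet // !index_eqE /=; case: (H =P _) => // _.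
by rewrite mulr0n subr0 mulr0 scale0r eqxx.
Qed.

Lemma F_bullet_circ C :
  F bullet circ (T C bullet) = (r * la * (sgc ^+ 2 - 1)) *: T C circ.
Proof.
rewrite (operator_gen FP) (@sum_only1 _ _ circ) => [|H].
  by rewrite /fval Rinv_bullet_circ_corner // gfac_circ invrK mulrA.
rewrite /fval.
have [->|/(Rinv_col_circ_bullet_support Ru) ->] := eqVneq (X bullet H circ bullet) 0.
  by rewrite mulr0 scale0r eqxx.
by rewrite rev_bullet.
Qed.

(** The origin of [tau]: it collects the middle components created when omega^bullet crosses
    [T C bullet], with the factors [qb b / r] produced by [F_bullet_mid]. *)
Lemma ract_wb C : ract (T C bullet) wb = (r ^- 2 *: T C bullet) *: wb
  - la%:A *: tau C + ((r * la * (sgc ^+ 2 - 1)) *: T C circ) *: oc.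
Proof.
rewrite ract_omega big_index F_bullet_bullet F_bullet_circ.
rewrite addrC addrA addrAC; congr (_ + _ + _).
rewrite -scaleNr -(scaleNr la) /tau scaler_sumr; apply: eq_bigr => d _.
by rewrite F_bullet_mid; exact: scale_kA.
Qed.

Lemma F_mid_bullet (b : 'I_N) C : F (mid b) bullet (T C bullet) = 0.
Proof.
rewrite (operator_gen FP) big1 // => H _.
by rewrite /fval Rinv_col_bullet // index_eqE /= mulr0 scale0r.
Qed.

Lemma F_mid_mid (b d : 'I_N) C :
  F (mid b) (mid d) (T C bullet) = ((qb b / r ^+ 2) *: T C bullet) *+ (b == d).
Proof.
rewrite (operator_gen FP) (@sum_only1 _ _ bullet) => [|H].
  rewrite /fval Rinv_col_mid_bullet // gfac_bullet !index_eqE /= mulr0n subr0.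
  have [->|_] := eqVneq b d; last by rewrite mulr0 scale0r.
  by rewrite /= mulr1n; congr (_ *: _); field; rewrite r0.
rewrite /fval Rinv_col_mid_bullet // !index_eqE /=; case: (H =P _) => // _.
by rewrite andbF !mulr0n subr0 mulr0 scale0r eqxx.
Qed.

Lemma F_mid_circ (b : 'I_N) C : F (mid b) circ (T C bullet) =
  (r / qb b * (la * sgc / sg (mid b))) *: T C (mid (rev_ord b)).
Proof.
rewrite (operator_gen FP) (@sum_only1 _ _ (mid (rev_ord b))) => [|H].
  rewrite /fval Rinv_mid_circ_bullet // -rev_mid (gfac_rev s r0 qP).
  by rewrite invrK gfac_mid.
rewrite /fval.
have [->|/(Rinv_col_circ_bullet_support Ru) ->] := eqVneq (X (mid b) H circ bullet) 0.
  by rewrite mulr0 scale0r eqxx.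
by rewrite rev_mid.
Qed.

Lemma ract_omega_mid E (b : 'I_N) : ract (T E bullet) (omega (mid b)) =
  ((qb b / r ^+ 2) *: T E bullet) *: omega (mid b)
  + ((r / qb b * (la * sgc / sg (mid b))) *: T E (mid (rev_ord b))) *: oc.
Proof.
rewrite ract_omega big_index F_mid_bullet scale0r addr0 F_mid_circ addrC.
congr (_ + _); rewrite (@sum_only1 _ _ b) => [|d]; first by rewrite F_mid_mid eqxx.
by rewrite F_mid_mid; case: (b =P d) => // _; rewrite scale0r eqxx.
Qed.

Lemma ract_tau C E : ract (T E bullet) (tau C) =
  \sum_b ((qb b ^+ 2 / r ^+ 3) *: (T C (mid b) * T E bullet)) *: omega (mid b)
  + (la * sgc)%:A *: ((\sum_b (sg (mid b))^-1 *:
      (T C (mid b) * T E (mid (rev_ord b)))) *: oc).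
Proof.
rewrite /tau ract_sum scaler_suml scaler_sumr -big_split; apply: eq_bigr => b _ /=.
rewrite ract_lmul ract_omega_mid scalerDr !scalerA; congr (_ *: _ + _ *: _).
  by rewrite -scalerAl -scalerAr scalerA; congr (_ *: _); field; rewrite r0.
rewrite -!scalerAl mul1r -scalerAr !scalerA; congr (_ *: _).
by field; rewrite S0 r0 Q0.
Qed.

Lemma ract_oc C : ract (T C bullet) oc = T C bullet *: oc.
Proof.
rewrite ract_omega (@sum_only1 _ _ circ) => [|D]; rewrite (operator_gen FP).
  rewrite (@sum_only1 _ _ bullet) => [|H].
    rewrite /fval Rinv_row_bullet // !eqxx mulr1n gfac_bullet gfac_circ.
    by rewrite invrK mulVf // scale1r.
  rewrite /fval.
  have [->|/(Rinv_col_circ_bullet_support Ru) ->] := eqVneq (X circ H circ bullet) 0.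
    by rewrite mulr0 scale0r eqxx.
  by rewrite rev_circ.
have [->//|[d ->]|->] := indexP D.
  rewrite big1 ?scale0r ?eqxx // => H _.
  by rewrite /fval Rinv_col_mid_bullet // !index_eqE /= !mulr0n subr0 mulr0 scale0r.
rewrite big1 ?scale0r ?eqxx // => H _.
by rewrite /fval Rinv_col_bullet // !index_eqE /= mulr0 scale0r.
Qed.

(* [tau] expanded with coefficients on the right of the [omega D]. *)
Definition nu D : K := sg D *
  \sum_b (sg (mid b))^-1 * X (mid b) (mid (rev_ord b)) D (rev_ord D).

Lemma nu_bullet : nu bullet = 0.
Proof.
rewrite /nu big1 ?mulr0 // => b _.
by rewrite Rinv_col_bullet // !index_eqE /= mulr0.
Qed.

Lemma nu_mid (d : 'I_N) : nu (mid d) = sgc ^+ 2 / r * sg (mid d) ^+ 2.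
Proof. by rewrite /nu rev_mid Rinv_twist //; ring. Qed.

Lemma nu_circ : nu circ = (sgc ^+ 2 - 1) * (sgc ^+ 2 / r + r).
Proof.
rewrite /nu rev_circ sum_Rinv_circ_bullet // Rinv_bullet_circ_corner //.
rewrite [X in _ * (_ * X)](_ : _ = la * (r^-1 * (sgc ^+ 2 - 1)
  + (1 - sgc ^- 2) * r)); last by ring.
rewrite [_ / la * _]mulrA divfK //; field; rewrite r0 S0 //.
Qed.

(** Moving the coefficients to the right by [lmul_omega] produces a priori every [T C H] next to
    [omega D]; since [Rinv] maps pairs (A, A') to such pairs, only H = D survives. *)
Lemma tau_right C : tau C = \sum_D ract (nu D *: T C D) (omega D).
Proof.
rewrite /tau; under eq_bigr do rewrite lmul_omega.
rewrite exchange_big; apply: eq_bigr => D _ /=.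
transitivity (ract (\sum_b G D (mid b) ((qb b / r) *: T C (mid b))) (omega D)).
  by elim/big_rec2: _ => [|b y y' _ ->]; [rewrite ract0l|rewrite ractDl].
congr ract.
transitivity (\sum_H (\sum_b qb b / r * gval r s q D (mid b) H (mid b)) *: T C H).
  under [RHS]eq_bigr do rewrite scaler_suml.
  rewrite exchange_big; apply: eq_bigr => b _ /=.
  rewrite (lin_Z (lG _ _)) (operator_gen GP) scaler_sumr.
  by apply: eq_bigr => H _; rewrite scalerA.
have gE H : \sum_b qb b / r * gval r s q D (mid b) H (mid b) =
    sg H * \sum_b (sg (mid b))^-1 * X (mid b) (mid (rev_ord b)) D (rev_ord H).
  rewrite mulr_sumr; apply: eq_bigr => b _.
  rewrite /gval /fval (gfac_rev s r0 qP) invrK gfac_mid rev_mid.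
  by field; rewrite r0 Q0 S0.
rewrite (@sum_only1 _ _ D) => [|H]; rewrite gE // => N0.
apply/eqP; apply: contraNT N0 => nHD.
rewrite big1 ?mulr0 ?scale0r ?eqxx // => b _.
have [->|/(Rinv_rev_support Ru)] := eqVneq (X (mid b) (mid (rev_ord b)) D (rev_ord H)) 0.
  by rewrite mulr0.
by rewrite rev_mid eqxx (inj_eq rev_ord_inj) (negbTE nHD).
Qed.

Definition eta (a : 'I_N) : forms := tau (mid a).

Lemma tau_bullet : tau bullet = 0.
Proof.
by rewrite /tau big1 // => b _; rewrite T_bullet_mid scaler0 scale0r.
Qed.

Lemma ract_u k w : k != 0 -> ract v w = (k *: v) *: w ->
  ract u w = (k^-1 *: u) *: w.
Proof.
move=> k0 vw; have : ract 1 w = (k *: v) *: ract u w.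
  by rewrite -mul_vu -ractM vw ract_lmul.
rewrite ract1 => {2}->.
by rewrite scalerA -scalerAl -scalerAr scalerA mul_uv mulVf // !scale1r.
Qed.

Lemma ract_x_wb a :
  ract (x a) wb = (r ^- 2 *: x a) *: wb - la%:A *: eta a.
Proof. by rewrite ract_wb T_mid_circ scaler0 scale0r addr0. Qed.

Lemma ract_v_wb : ract v wb = (r ^- 2 *: v) *: wb.
Proof.
by rewrite ract_wb tau_bullet T_bullet_circ !scaler0 scale0r subr0 addr0.
Qed.

Lemma ract_u_wb : ract u wb = (r ^+ 2 *: u) *: wb.
Proof.
by rewrite (ract_u _ ract_v_wb) ?invrK // invr_eq0 expf_neq0.
Qed.

Lemma ract_u_oc : ract u oc = u *: oc.
Proof.
rewrite (@ract_u 1) ?oner_eq0 // ?invr1 ?scale1r //.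
exact: ract_oc.
Qed.

Lemma ract_v_eta a : ract v (eta a) = ((qb a / r ^+ 2) *: v) *: eta a.
Proof.
rewrite /eta ract_tau [X in _ + _ *: (X *: _)]big1 => [|b _]; last first.
  by rewrite T_bullet_mid mulr0 scaler0.
rewrite scale0r scaler0 addr0 scaler_sumr; apply: eq_bigr => b _.
rewrite scalerA mul_Tv -scalerAl -scalerAr !scalerA; congr (_ *: _ *: _).
by field; rewrite r0 Q0.
Qed.

Lemma ract_u_eta a : ract u (eta a) = ((r ^+ 2 / qb a) *: u) *: eta a.
Proof.
rewrite (ract_u _ (ract_v_eta a)) ?invf_div //.
by rewrite mulf_neq0 ?invr_eq0 ?expf_neq0.
Qed.

(** The entries of T outside the plane disappear: [mul_Tx] brings x to the left so that the
    remaining T recombine into eta, and in the coefficient of omega^circ the metric relation turns a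
    quadratic sum of T into a scalar. *)
Lemma ract_x_eta a d : ract (x d) (eta a) =
  (r^-1)%:A *: (\sum_e \sum_f (R (mid d) (mid a) (mid e) (mid f))%:A *: (x e *: eta f))
  + ((la * sgc / sg (mid a)) *+ (a == rev_ord d))%:A *: oc.
Proof.
rewrite /eta ract_tau T_mid_metric; congr (_ + _); last first.
  by rewrite scale_kAA mulrnAr.
rewrite !scaler_sumr.
transitivity (\sum_b \sum_e \sum_f
    ((R (mid d) (mid a) (mid e) (mid f) * qb b / r ^+ 2) *: (x e * T (mid f) (mid b)))
    *: omega (mid b)).
  apply: eq_bigr => b _; rewrite mul_Tx scalerA scaler_sumr scaler_suml.
  apply: eq_bigr => e _; rewrite scaler_sumr scaler_suml.
  apply: eq_bigr => f _; rewrite scalerA; congr (_ *: _ *: _).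
  by field; rewrite r0 Q0.
rewrite exchange_big; apply: eq_bigr => e _ /=.
rewrite exchange_big scaler_sumr; apply: eq_bigr => f _ /=.
rewrite /tau scale_kAA !scaler_sumr; apply: eq_bigr => b _.
rewrite !scalerA -!scalerAl mul1r -!scalerAr scalerA; congr (_ *: _ *: _).
by field; rewrite r0.
Qed.

(** The middle block of [Rinv] inverts the middle block of R: in the full product, any term with an
    extreme summation index has a vanishing factor. *)
Lemma Rinv_Rmat_mid (g h e f : 'I_N) :
  \sum_d \sum_a X (mid g) (mid h) (mid d) (mid a) * R (mid d) (mid a) (mid e) (mid f)
  = ((g == e) && (h == f))%:R.
Proof.
have := Rinv_Rmat Ru (mid g) (mid h) (mid e) (mid f); rewrite !mid_eq => <-.
have z0 D E : (D \notin codom (@mid N)) || (E \notin codom (@mid N)) ->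
    X (mid g) (mid h) D E * R D E (mid e) (mid f) = 0.
  case: (indexP D) => [->|[d ->]|->] nDE.
  - have [->|/Rmat_row_circ[/eqP]] := eqVneq (R circ E (mid e) (mid f)) 0.
      by rewrite mulr0.
    by rewrite index_eqE.
  - case: (indexP E) nDE => [->|[a ->]|->]; last 1 first.
    + by rewrite Rinv_col_mid_bullet // !index_eqE andbF /= !mulr0n subr0 mul0r.
    + by rewrite Rinv_col_circ // index_eqE andbF mulr0n mul0r.
    by rewrite !codom_f.
  by rewrite Rinv_col_bullet // index_eqE mulr0n mul0r.
have nc : @circ N \notin codom (@mid N) by apply/codomP => -[i /eqP]; rewrite index_eqE.
have nb : @bullet N \notin codom (@mid N) by apply/codomP => -[i /eqP]; rewrite index_eqE.
rewrite [RHS]big_index [X in X + _ + _]big1 => [|E _]; last by rewrite z0 ?nc.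
rewrite [X in _ + X]big1 => [|E _]; last by rewrite z0 ?nb.
rewrite addr0 add0r; apply: eq_bigr => d _.
by rewrite [RHS]big_index z0 ?nc ?orbT // add0r z0 ?nb ?orbT // addr0.
Qed.

(** [ract_x_eta] solved for its left products, by the inverse of the middle block of R. *)
Lemma x_eta g h : x g *: eta h = \sum_d \sum_a
  (r * X (mid g) (mid h) (mid d) (mid a))%:A *: (ract (x d) (eta a)
    - ((la * sgc / sg (mid a)) *+ (a == rev_ord d))%:A *: oc).
Proof.
under eq_bigr do under eq_bigr do rewrite ract_x_eta addrK scale_kAA.
transitivity (\sum_e \sum_f (\sum_d \sum_a X (mid g) (mid h) (mid d) (mid a)
   * R (mid d) (mid a) (mid e) (mid f))%:A *: (x e *: eta f)).
  rewrite (@sum_pair_only1 _ _ _ g h) => [|e f]; rewrite Rinv_Rmat_mid.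
    by rewrite !eqxx !scale1r.
  by case: (g =P e) => [->|_]; case: (h =P f) => [->|_] //; rewrite !scale0r eqxx.
have sumA (c : 'I_N -> 'I_N -> K) w :
    (\sum_d \sum_a c d a)%:A *: w = \sum_d \sum_a (c d a)%:A *: w.
  rewrite !scaler_suml; apply: eq_bigr => d _.
  by rewrite !scaler_suml.
transitivity (\sum_e \sum_f \sum_(p : 'I_N * 'I_N)
   (X (mid g) (mid h) (mid p.1) (mid p.2)
     * R (mid p.1) (mid p.2) (mid e) (mid f))%:A *: (x e *: eta f)).
  apply: eq_bigr => e _; apply: eq_bigr => f _.
  rewrite (sumA (fun d a => X (mid g) (mid h) (mid d) (mid a)
    * R (mid d) (mid a) (mid e) (mid f))).
  by rewrite pair_big.
rewrite pair_big exchange_big [RHS]pair_big; apply: eq_bigr => -[d a] _ /=.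
rewrite [X in _ *: X]pair_big scaler_sumr; apply: eq_bigr => -[e f] _ /=.
by rewrite scale_kAA; congr (_%:A *: _); field; rewrite r0.
Qed.

(** By its definition [tau circ] has coefficients [T circ (mid b)]; eliminating them puts it in the
    left M-span of the eta, as needed to solve dz for omega^circ. *)
Lemma tau_circ_left : tau circ = - ((sgc^-1)%:A *:
  (u *: \sum_a ((sg (mid a))^-1)%:A *: (x a *: eta (rev_ord a)))).
Proof.
rewrite /tau !scaler_sumr -sumrN.
transitivity (\sum_b \sum_a - (((sgc^-1 * (sg (mid a))^-1 * (qb b / r)) *:
   (u * (x a * T (mid (rev_ord a)) (mid b)))) *: omega (mid b))).
  apply: eq_bigr => b _; rewrite T_circ_mid_left scalerN scaleNr mulr_sumr.
  rewrite !scaler_sumr scaler_suml -sumrN; apply: eq_bigr => a _.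
  by rewrite -scalerAr !scalerA; congr (- (_ *: _ *: _)); ring.
rewrite exchange_big; apply: eq_bigr => a _ /=.
rewrite lmul_kA scale_kAA scalerA /eta /tau !scaler_sumr -sumrN.
apply: eq_bigr => b _; rewrite !scalerA; congr (- (_ *: _)).
by rewrite -!scalerAl mul1r -!scalerAr scalerA !mulrA.
Qed.

Lemma eta_right a : eta a = \sum_d ract (nu (mid d) *: T (mid a) (mid d)) (omega (mid d)).
Proof.
rewrite /eta tau_right big_index nu_bullet T_mid_circ scaler0 !scale0r.
by rewrite !ract0l add0r addr0.
Qed.

(** Unlike the left form, the right form keeps a multiple of omega^circ, since [nu circ] need not
    vanish. This shifts the coefficient to be inverted from [beta] to [beta - nu circ]. *)
Lemma tau_circ_right : tau circ = ract (nu circ *: u) oc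
  - sgc%:A *: \sum_a ((sg (mid a))^-1)%:A *: ract (x (rev_ord a) * u) (eta a).
Proof.
rewrite tau_right big_index nu_bullet !scale0r.
rewrite ract0l addr0; congr (_ + _).
transitivity (\sum_d \sum_a - ract ((sgc * (sg (mid a))^-1 * nu (mid d)) *:
   (T (mid a) (mid d) * x (rev_ord a) * u)) (omega (mid d))).
  apply: eq_bigr => d _; rewrite T_circ_mid_right.
  rewrite scalerN mulr_suml !scaler_sumr -scaleN1r ractZ scaleNr scale1r scaleN1r.
  rewrite sumrN; congr (- _).
  rewrite -[RHS]/(\sum_a _).
  elim/big_rec2: _ => [|a y y' _ <-]; first exact: ract0l.
  by rewrite ractDl -scalerAl !scalerA; congr (ract (_ *: _) _ + _); ring.
rewrite exchange_big scaler_sumr -sumrN; apply: eq_bigr => a _ /=.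
rewrite scale_kAA eta_right ract_sum scaler_sumr -sumrN; apply: eq_bigr => d _.
by rewrite ractM -ractZ -!scalerAl scalerA !mulrA.
Qed.

Definition inner_diff (a : A) : forms := (la^-1)%:A *: (ract a wb - a *: wb).

Lemma inner_diff_gen C : inner_diff (T C bullet) = - ((r^-1)%:A *: (T C bullet *: wb)) - tau C
  + ((r * (sgc ^+ 2 - 1)) *: T C circ) *: oc.
Proof.
have e : ract (T C bullet) wb - T C bullet *: wb =
    (r ^- 2 - 1)%:A *: (T C bullet *: wb) - la%:A *: tau C
    + ((r * la * (sgc ^+ 2 - 1)) *: T C circ) *: oc.
  rewrite ract_wb [(r ^- 2 *: _) *: _]scale_kA [(r ^- 2 - 1)%:A]scalerBl scale1r.
  rewrite [(_ - 1) *: _]scalerBl scale1r.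
  by rewrite addrAC -!addrA; congr (_ + _); rewrite addrCA; congr (_ + _); rewrite addrC.
rewrite /inner_diff e scalerDr scalerBr !scale_kAA mulVf // scale1r scale1r.
rewrite -scale_kA scalerA; congr (_ - _ + _ *: _).
  have -> : r ^- 2 - 1 = la * - r^-1 by field; rewrite r0.
  by rewrite mulKf // scaleNr scaleNr scale_kA.
rewrite -scalerAl mul1r scalerA; congr (_ *: _).
by rewrite [r * la]mulrC -mulrA mulKf.
Qed.


Hypotheses (sgc1 : sgc ^+ 2 != 1) (kap0 : sgc^-1 * r ^+ 2 + sgc != 0).
Local Notation kap := (sgc^-1 * r ^+ 2 + sgc).
Local Notation M := (plane T).
Local Notation rmul := (fun a b : A => b * a).

(** * The plane and the bimodule spanned by the frame *)

Lemma lmul_action : is_action *%R (@form_lmul N A).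
Proof.
split=> *; rewrite /form_lmul ?scalerDl ?scalerDr ?scalerA ?scale1r //.
Qed.

Lemma ract_action : is_action rmul ract.
Proof.
split=> *; [exact: ractDl|exact: ractDr|exact: ractM|exact: ract1].
Qed.

Lemma plane_subring_l : is_subring_for *%R M.
Proof. by apply: subalgebra_subring; left. Qed.

Lemma plane_subring_r : is_subring_for rmul M.
Proof. by apply: subalgebra_subring; right. Qed.

Lemma plane_x a : M (x a). Proof. exact/SubalgGen/PlaneX. Qed.
Lemma plane_u : M u. Proof. exact/SubalgGen/PlaneU. Qed.
Lemma plane_v : M v. Proof. exact/SubalgGen/PlaneV. Qed.

Lemma plane_sum (I : Type) (t : seq I) (P : I -> A) :
  (forall i, M (P i)) -> M (\sum_(i <- t) P i).
Proof.
move=> MP; elim/big_ind: _ => //; first exact: subring0 plane_subring_l.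
exact: SubalgD.
Qed.

Lemma plane_quad_L : M (quad_L T s).
Proof.
apply: plane_sum => e; apply: plane_sum => f; apply: SubalgZ.
by apply: SubalgM; exact: plane_x.
Qed.

Lemma plane_z : M z.
Proof.
have -> : z = - kap^-1 *: (u * quad_L T s).
  rewrite quad_LE mulrN scalerN -scaleNr opprK -scalerAr scalerA mulVf // scale1r.
  by rewrite mulrA mul_uv mul1r.
by apply: SubalgZ; apply: SubalgM; [exact: plane_u|exact: plane_quad_L].
Qed.

Lemma plane_Z k a : M a -> M (k *: a). Proof. exact: SubalgZ. Qed.

(* The coefficients of [d x], [d z], [d v] on the [omega B] involve [T a b],
   which is not in the plane; on this family they lie in it. *)
Definition frame (i : 'I_N + bool) : forms :=
  match i with inl a => eta a | inr false => oc | inr true => wb end.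

Local Notation lspan := (in_span (@form_lmul N A) M).
Local Notation rspan := (in_span ract M).

Section SubmoduleClosure.
Variables (W : forms -> Prop).

Section Left.
Hypothesis WP : is_submodule (@form_lmul N A) M W.

Lemma lsub_scale a w : M a -> W w -> W (a *: w).
Proof. exact: (submoduleZ WP). Qed.

Lemma lsub_K k w : W w -> W (k%:A *: w).
Proof. exact/lsub_scale/subalgebra_scalar. Qed.

Lemma lsub_N w : W w -> W (- w).
Proof. by rewrite -scaleN1r -scaleN1r; exact: lsub_K. Qed.

Lemma lsub_sum (I : Type) (t : seq I) (P : I -> forms) :
  (forall i, W (P i)) -> W (\sum_(i <- t) P i).
Proof. exact: submodule_sum WP. Qed.
End Left.

Section Right.
Hypothesis WP : is_submodule ract M W.

Lemma rsub_scale a w : M a -> W w -> W (ract a w).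
Proof. exact: (submoduleZ WP). Qed.

Lemma rsub_K k w : W w -> W (k%:A *: w).
Proof.
by move=> Ww; rewrite -[w]ract1 -ractZ; apply: rsub_scale => //; exact: subalgebra_scalar.
Qed.

Lemma rsub_N w : W w -> W (- w).
Proof. by rewrite -scaleN1r -scaleN1r; exact: rsub_K. Qed.

Lemma rsub_sum (I : Type) (t : seq I) (P : I -> forms) :
  (forall i, W (P i)) -> W (\sum_(i <- t) P i).
Proof. exact: submodule_sum WP. Qed.
End Right.
End SubmoduleClosure.

Let lP I e := span_submodule lmul_action plane_subring_l (I := I) e.
Let rP I e := span_submodule ract_action plane_subring_r (I := I) e.
Let lmem (I : finType) (e : I -> forms) i : lspan e (e i) :=
  mem_span lmul_action plane_subring_l e i.
Let rmem (I : finType) (e : I -> forms) i : rspan e (e i) :=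
  mem_span ract_action plane_subring_r e i.
Local Hint Resolve lP rP plane_x plane_u plane_v plane_z : core.

Lemma lspan_frame_ract m w : M m -> lspan frame w -> lspan frame (ract m w).
Proof.
apply: (span_stable lmul_action ract_action) => //; [by left|by right| | |].
- by move=> a b w'; exact: ract_lmul.
- by move=> k a w'; exact: ractZ.
have fe a : lspan frame (eta a) := lmem frame (inl a).
have fo : lspan frame oc := lmem frame (inr false).
have fw : lspan frame wb := lmem frame (inr true).
move=> y i [d||]; case: i => [a|[]] /=; rewrite /gen_x /gen_u /gen_v.
- rewrite ract_x_eta; apply: (submoduleD (lP _)); apply: lsub_K => //.
  apply: lsub_sum => // e; apply: lsub_sum => // f.
  by apply: lsub_K => //; apply: lsub_scale.
- rewrite ract_x_wb; apply: (submoduleD (lP _)).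
    by apply: lsub_scale => //; exact: plane_Z.
  by apply: lsub_N => //; exact: lsub_K.
- by rewrite ract_oc; exact: lsub_scale.
- by rewrite ract_u_eta; apply: lsub_scale => //; exact: plane_Z.
- by rewrite ract_u_wb; apply: lsub_scale => //; exact: plane_Z.
- by rewrite ract_u_oc; exact: lsub_scale.
- by rewrite ract_v_eta; apply: lsub_scale => //; exact: plane_Z.
- by rewrite ract_v_wb; apply: lsub_scale => //; exact: plane_Z.
by rewrite ract_oc; exact: lsub_scale.
Qed.

Lemma lmul_eq_ract k a w : k != 0 -> ract a w = (k *: a) *: w ->
  a *: w = ract (k^-1 *: a) w.
Proof. by move=> k0 H; rewrite ractZ H -scale_kA scalerA mulVf // scale1r. Qed.

(** Each commutation relation is solved for its left product. This is a division by a scalar except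
    for [x d *: eta a], where [x_eta] is needed. *)
Lemma rspan_frame_lmul m w : M m -> rspan frame w -> rspan frame (m *: w).
Proof.
apply: (span_stable ract_action lmul_action) => //; [by right|by left| | |].
- by move=> a b w'; rewrite /form_lmul ract_lmul.
- by move=> k a w'; rewrite /form_lmul scale_kA ractZ ract1.
have fe a : rspan frame (eta a) := rmem frame (inl a).
have fo : rspan frame oc := rmem frame (inr false).
have fw : rspan frame wb := rmem frame (inr true).
have tr k a y w' : y *: w' = ract (k *: a) w' -> M a -> rspan frame w' ->
    rspan frame (y *: w').
  by move=> -> Ma; apply: rsub_scale => //; exact: plane_Z.
move=> y i [d||]; case: i => [a|[]] /=; rewrite /form_lmul /gen_x /gen_u /gen_v.
- rewrite x_eta; apply: rsub_sum => // e; apply: rsub_sum => // f.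
  apply: rsub_K => //; apply: (submoduleD (rP _)); first exact: rsub_scale.
  by apply: rsub_N => //; exact: rsub_K.
- have -> : x d *: wb = (r ^+ 2)%:A *: (ract (x d) wb + la%:A *: eta d).
    rewrite ract_x_wb subrK -scale_kA scalerA mulfV ?scale1r //.
    by rewrite expf_neq0.
  apply: rsub_K => //; apply: (submoduleD (rP _)); first exact: rsub_scale.
  exact: rsub_K.
- by rewrite -ract_oc; exact: rsub_scale.
- apply: (tr _ u) => //; apply: (lmul_eq_ract _ (ract_u_eta a)).
  by rewrite mulf_neq0 ?invr_eq0 ?expf_neq0.
- by apply: (tr _ u) => //; apply: (lmul_eq_ract _ ract_u_wb); rewrite expf_neq0.
- by rewrite -ract_u_oc; exact: rsub_scale.
- apply: (tr _ v) => //; apply: (lmul_eq_ract _ (ract_v_eta a)).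
  by rewrite mulf_neq0 ?invr_eq0 ?expf_neq0.
- apply: (tr _ v) => //; apply: (lmul_eq_ract _ ract_v_wb).
  by rewrite invr_eq0 expf_neq0.
by rewrite -ract_oc; exact: rsub_scale.
Qed.


(** * The differential and the bimodule it generates *)

Variables (d : A -> forms) (Gamma : forms -> Prop).
Hypothesis dE : forall a, d a = inner_diff a.
Hypothesis GammaP : forall w, Gamma w <-> exists t : seq (A * A),
  (forall y, y \in t -> M y.1 /\ M y.2) /\ w = \sum_(y <- t) y.1 *: d y.2.

Lemma ract_wbE a : ract a wb = la%:A *: d a + a *: wb.
Proof. by rewrite dE /inner_diff scale_kAA mulfV // scale1r scale1r subrK. Qed.

Lemma d_leibniz a b : d (a * b) = a *: d b + ract b (d a).
Proof.
have lN w w' : la%:A *: w = la%:A *: w' -> w = w'.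
  by move=> /(congr1 ( *:%R ((la^-1)%:A : A))); rewrite !scale_kAA mulVf // !scale1r.
apply: lN; rewrite scalerDr -lmul_kA -ract_lmul.
have dl c : la%:A *: d c = ract c wb - c *: wb by rewrite ract_wbE addrK.
rewrite !dl scalerBr scalerA ractDr.
have -> : ract b (- (a *: wb)) = - (a *: ract b wb).
  by rewrite -scaleN1r ract_lmul scaleN1r ract_lmul.
by rewrite ractM [RHS]addrC addrA subrK.
Qed.

Lemma Gamma_gen a b : M a -> M b -> Gamma (a *: d b).
Proof.
move=> Ma Mb; apply/GammaP; exists [:: (a, b)]; rewrite big_seq1.
by split=> // y; rewrite inE => /eqP->.
Qed.

Lemma Gamma_d b : M b -> Gamma (d b).
Proof. by rewrite -(scale1r (d b)); apply: Gamma_gen; exact: Subalg1. Qed.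

Lemma Gamma0 : Gamma 0.
Proof. by apply/GammaP; exists [::]; rewrite big_nil. Qed.

Lemma GammaD w w' : Gamma w -> Gamma w' -> Gamma (w + w').
Proof.
move=> /GammaP[t [tM ->]] /GammaP[t' [tM' ->]]; apply/GammaP.
exists (t ++ t'); rewrite big_cat; split=> // y.
by rewrite mem_cat => /orP[/tM|/tM'].
Qed.

Lemma Gamma_ind (P : forms -> Prop) : P 0 ->
  (forall a b w, M a -> M b -> P w -> P (a *: d b + w)) ->
  forall w, Gamma w -> P w.
Proof.
move=> P0 PD w /GammaP[t [tM ->]].
elim: t tM => [|[a b] t IHt] tM; first by rewrite big_nil.
rewrite big_cons; have [Ma Mb] := tM _ (mem_head _ _).
by apply: PD => //; apply: IHt => y yt; apply: tM; rewrite inE yt orbT.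
Qed.

Lemma Gamma_submodule_l : is_submodule (@form_lmul N A) M Gamma.
Proof.
split=> [||m w Mm]; [exact: Gamma0|exact: GammaD|].
move: w; apply: Gamma_ind; first by rewrite /form_lmul scaler0; exact: Gamma0.
move=> a b w Ma Mb Gw; rewrite /form_lmul scalerDr scalerA.
by apply: GammaD => //; apply: Gamma_gen => //; exact: SubalgM.
Qed.

Lemma Gamma_submodule_r : is_submodule ract M Gamma.
Proof.
split=> [||m w Mm]; [exact: Gamma0|exact: GammaD|].
move: w; apply: Gamma_ind; first by rewrite ract0r; exact: Gamma0.
move=> a b w Ma Mb Gw; rewrite ractDr ract_lmul.
apply: GammaD => //.
have -> : ract m (d b) = d (b * m) - b *: d m by rewrite d_leibniz addrC addKr.
rewrite scalerBr scalerA -scaleNr; apply: GammaD; apply: Gamma_gen => //.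
  exact: SubalgM.
by rewrite -scaleN1r; apply: plane_Z; exact: SubalgM.
Qed.

Lemma d_lspan_frame b : M b -> lspan frame (d b).
Proof.
move=> Mb; rewrite dE /inner_diff; apply: lsub_K => //; apply: (submoduleD (lP _)).
  by apply: lspan_frame_ract => //; exact: lmem frame (inr true).
apply: lsub_N => //; apply: lsub_scale => //; exact: lmem frame (inr true).
Qed.

Lemma d_rspan_frame b : M b -> rspan frame (d b).
Proof.
move=> Mb; rewrite dE /inner_diff; apply: rsub_K => //; apply: (submoduleD (rP _)).
  by apply: rsub_scale => //; exact: rmem frame (inr true).
apply: rsub_N => //; apply: rspan_frame_lmul => //; exact: rmem frame (inr true).
Qed.

Lemma Gamma_lspan_frame w : Gamma w -> lspan frame w.
Proof.
move: w; apply: Gamma_ind; first exact: submodule0 (lP _).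
move=> a b w Ma Mb lw; apply: (submoduleD (lP _)) => //.
by apply: lsub_scale => //; exact: d_lspan_frame.
Qed.

Lemma Gamma_rspan_frame w : Gamma w -> rspan frame w.
Proof.
move: w; apply: Gamma_ind; first exact: submodule0 (rP _).
move=> a b w Ma Mb rw; apply: (submoduleD (rP _)) => //.
by apply: rspan_frame_lmul => //; exact: d_rspan_frame.
Qed.

Local Notation beta := (r * (sgc ^+ 2 - 1)).

Lemma d_T C : d (T C bullet) = - ((r^-1)%:A *: (T C bullet *: wb)) - tau C
  + (beta *: T C circ) *: oc.
Proof. by rewrite dE inner_diff_gen. Qed.

Lemma d_x a : d (x a) = - ((r^-1)%:A *: (x a *: wb)) - eta a.
Proof. by rewrite d_T T_mid_circ scaler0 scale0r addr0. Qed.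

Lemma d_v : d v = - ((r^-1)%:A *: (v *: wb)).
Proof. by rewrite d_T tau_bullet T_bullet_circ scaler0 scale0r addr0 subr0. Qed.

Lemma wb_l : wb = - (r%:A *: (u *: d v)).
Proof.
rewrite d_v !scalerN opprK lmul_kA scale_kAA mulfV // scale1r scale1r.
by rewrite scalerA mul_uv scale1r.
Qed.

Lemma beta0 : beta != 0.
Proof. by rewrite mulf_neq0 // subr_eq0. Qed.

(** * The differentials span the frame *)

Local Notation Dz := (diff_family T d z).

Lemma ractN a w : ract a (- w) = - ract a w.
Proof. by rewrite -scaleN1r ract_lmul scaleN1r. Qed.

Lemma add_cancel4 (w1 w2 w3 : forms) : - w1 - w2 + w3 + w1 + w2 = w3.
Proof. by rewrite -addrA -opprD addrAC addNr add0r. Qed.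

Lemma add_cancel5 (w1 p S y : forms) : - w1 - (p - S) + y + w1 - S = y - p.
Proof.
rewrite -[X in X - S](addrK (p - S)) add_cancel4 opprB addrA addrAC.
by rewrite addrK.
Qed.

(** A triangular system: dv gives omega^bullet, then dx^a gives eta^a, and dz gives omega^circ
    because [beta] is nonzero and [tau circ] is in the span of the eta. *)
Lemma frame_lspan i : lspan Dz (frame i).
Proof.
have dx a : lspan Dz (d (x a)) := lmem Dz (inl a).
have dz : lspan Dz (d z) := lmem Dz (inr false).
have dv : lspan Dz (d v) := lmem Dz (inr true).
have dw : lspan Dz wb.
  by rewrite wb_l; apply: lsub_N => //; apply: lsub_K => //; exact: lsub_scale.
have de a : lspan Dz (eta a).
  have -> : eta a = - d (x a) - (r^-1)%:A *: (x a *: wb).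
    by rewrite d_x opprB opprK addrK.
  apply: (submoduleD (lP _)); apply: lsub_N => //.
  by apply: lsub_K => //; exact: lsub_scale.
case: i => [a|[]] //=.
have -> : oc = (beta^-1)%:A *: (v *:
    (d z + (r^-1)%:A *: (z *: wb) + tau circ)).
  rewrite d_T add_cancel4 [(beta *: _) *: _]scale_kA lmul_kA scale_kAA mulVf ?beta0 //.
  by rewrite scale1r scale1r scalerA mul_vu scale1r.
apply: lsub_K => //; apply: lsub_scale => //.
apply: (submoduleD (lP _)); first apply: (submoduleD (lP _)) => //.
  by apply: lsub_K => //; exact: lsub_scale.
rewrite tau_circ_left; apply: lsub_N => //; apply: lsub_K => //.
apply: lsub_scale => //; apply: lsub_sum => // a; apply: lsub_K => //.
exact: lsub_scale.
Qed.

(** The same triangular system from the right. The part of [tau circ] along omega^circ changes the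
    pivot into [beta - nu circ], which is -(r^N - 1) r^(N-1). *)
Lemma frame_rspan i : rspan Dz (frame i).
Proof.
have dx a : rspan Dz (d (x a)) := rmem Dz (inl a).
have dz : rspan Dz (d z) := rmem Dz (inr false).
have dv : rspan Dz (d v) := rmem Dz (inr true).
have dw : rspan Dz wb.
  have -> : wb = - ((r^-1)%:A *: ract u (d v)).
    rewrite d_v ractN !ract_lmul ract_u_wb scalerN opprK [(_ *: u) *: _]scale_kA.
    rewrite [v *: _]lmul_kA [v *: _]scalerA mul_vu scale1r !scale_kAA.
    rewrite (_ : _ * _ = 1) ?scale1r ?scale1r //; field; rewrite r0 //.
  by apply: rsub_N => //; apply: rsub_K => //; exact: rsub_scale.
(* The differential is a commutator with omega^bullet, so a left multiple of omega^bullet is a right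
   multiple minus a multiple of the differential. *)
have awb a : M a -> rspan Dz (d a) -> rspan Dz (a *: wb).
  move=> Ma da; have -> : a *: wb = ract a wb - la%:A *: d a by rewrite ract_wbE addrAC subrr add0r.
  apply: (submoduleD (rP _)); first exact: rsub_scale.
  by apply: rsub_N => //; exact: rsub_K.
have de a : rspan Dz (eta a).
  have -> : eta a = - d (x a) - (r^-1)%:A *: (x a *: wb).
    by rewrite d_x opprB opprK addrK.
  apply: (submoduleD (rP _)); apply: rsub_N => //.
  by apply: rsub_K => //; exact: awb.
case: i => [a|[]] //=.
have bn : beta - nu circ != 0.
  have -> : beta - nu circ = - ((sgc ^+ 2 - 1) * (sgc ^+ 2 / r)).
    by rewrite nu_circ; ring.
  by rewrite oppr_eq0 !mulf_neq0 ?subr_eq0 ?expf_neq0 ?invr_eq0.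
have -> : oc = ((beta - nu circ)^-1)%:A *: ract v
    (d z + (r^-1)%:A *: (z *: wb) - sgc%:A *:
      \sum_a ((sg (mid a))^-1)%:A *: ract (x (rev_ord a) * u) (eta a)).
  rewrite d_T tau_circ_right; set S := sgc%:A *: _.
  rewrite [_ - _ + _ + _ - _](_ : _ = (beta - nu circ)%:A *: (u *: oc)).
    rewrite !ract_lmul ract_oc scale_kAA mulVf // scale1r scale1r.
    by rewrite scalerA mul_uv scale1r.
  by rewrite add_cancel5 ractZ ract_u_oc [(beta *: u) *: _]scale_kA -scalerBl -scalerBl.
apply: rsub_K => //; apply: rsub_scale => //.
apply: (submoduleD (rP _)); first apply: (submoduleD (rP _)) => //.
  by apply: rsub_K => //; exact: awb.
apply: rsub_N => //; apply: rsub_K => //; apply: rsub_sum => // a.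
apply: rsub_K => //; apply: rsub_scale => //.
by apply: SubalgM; [exact: plane_x|exact: plane_u].
Qed.

(** * Independence of the differentials *)

Definition plane_index (i : 'I_N + bool) : 'I_N.+2 :=
  match i with inl a => mid a | inr false => circ | inr true => bullet end.

Lemma plane_index_bij : bijective plane_index.
Proof.
apply: inj_card_bij; last by rewrite card_sum card_bool !card_ord addn2.
by move=> [a|[]] [b|[]] //= /eqP; rewrite index_eqE // => /eqP ->.
Qed.

(** The elements x^a, z and v together are the last column of T, so independence of their
    differentials can be referred to the matrix T. *)
Lemma DzE i : Dz i = d (T (plane_index i) bullet).
Proof. by case: i => [a|[]]. Qed.

(** [TTC] says that T times the metric times the transpose of T is the metric. Read from the left it
    cancels T after a row vector; read from the right, in [T_col_indep], it cancels the transpose of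
    T before a column. *)
Lemma T_row_indep (c : 'I_N.+2 -> A) :
  (forall D, \sum_C c C * T C D = 0) -> forall C, c C = 0.
Proof.
move=> c0 E.
have : \sum_B (sg B)^-1 *: ((\sum_C c C * T C B) * T (rev_ord E) (rev_ord B)) = 0.
  by rewrite big1 // => B _; rewrite c0 mul0r scaler0.
under eq_bigr do rewrite mulr_suml scaler_sumr.
rewrite exchange_big /= (@sum_only1 _ _ E) => [|C].
  under eq_bigr do rewrite -mulrA scalerAr.
  rewrite -mulr_sumr TTC rev_ordK eqxx mulr1n -scalerAr mulr1.
  by move=> /eqP; rewrite scaler_eq0 invr_eq0 (negbTE (S0 E)) => /eqP.
under eq_bigr do rewrite -mulrA scalerAr.
rewrite -mulr_sumr TTC rev_ordK; case: (C =P E) => // _.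
by rewrite scale0r mulr0 eqxx.
Qed.

Lemma T_col_indep (c : 'I_N.+2 -> A) :
  (forall D, \sum_C T C D * c C = 0) -> forall C, c C = 0.
Proof.
move=> c0 E.
have : \sum_B (sg B)^-1 *: (T (rev_ord E) B * (\sum_C T C (rev_ord B) * c C)) = 0.
  by rewrite big1 // => B _; rewrite c0 mulr0 scaler0.
under eq_bigr do rewrite mulr_sumr scaler_sumr.
rewrite exchange_big /= (@sum_only1 _ _ E) => [|C].
  under eq_bigr do rewrite mulrA scalerAl.
  rewrite -mulr_suml TTC eqxx mulr1n -scalerAl mul1r.
  by move=> /eqP; rewrite scaler_eq0 invr_eq0 (negbTE (S0 _)) => /eqP.
under eq_bigr do rewrite mulrA scalerAl.
rewrite -mulr_suml TTC (inj_eq rev_ord_inj); case: (E =P C) => [->//|_].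
by rewrite scale0r mul0r eqxx.
Qed.

Lemma big_plane_index (c : 'I_N + bool -> A) (P : A -> forms -> forms) :
  exists c' : 'I_N.+2 -> A, (forall i, c' (plane_index i) = c i) /\
  \sum_i P (c i) (Dz i) = \sum_C P (c' C) (d (T C bullet)).
Proof.
have [g gK Kg] := plane_index_bij; exists (c \o g); split=> [i|] /=.
  by rewrite gK.
rewrite (reindex plane_index) /=; last exact/onW_bij/plane_index_bij.
by apply: eq_bigr => i _; rewrite gK DzE.
Qed.

Lemma d_T_left : exists h : 'I_N.+2 -> K, (forall D, h D != 0) /\
  forall C, d (T C bullet) = \sum_D (h D *: T C D) *: omega D.
Proof.
exists (fun D => if D == circ then beta else if D == bullet then - r^-1
  else - (q D bullet / r)); split=> [D|C].
  case: ifP => _; first exact: beta0.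
  case: ifP => _; rewrite oppr_eq0 ?invr_eq0 // mulf_neq0 ?invr_eq0 //.
  exact: qparam_neq0 qP _ _.
rewrite d_T big_index !index_eqE addrC addrA addrAC; congr (_ + _ + _).
  by rewrite scaleNr scaleNr -scale_kA.
rewrite /tau -sumrN; apply: eq_bigr => b _.
by rewrite !index_eqE scaleNr scaleNr.
Qed.

Lemma lmul_oc C : T C circ *: oc = ract (T C circ) oc.
Proof.
have [->|[c ->]|->] := indexP C; first by rewrite ract_u_oc.
  by rewrite T_mid_circ ract0l scale0r.
by rewrite T_bullet_circ ract0l scale0r.
Qed.

(** [d_T] with the left multiple of omega^bullet replaced by a right one. By [ract_wbE] the exchange
    costs a multiple of the differential itself, whence the factor r^-2 = 1 - r^-1 (r - r^-1). *)
Lemma d_T_twisted C : (r ^- 2)%:A *: d (T C bullet) =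
  - ((r^-1)%:A *: ract (T C bullet) wb) - tau C + (beta *: T C circ) *: oc.
Proof.
have -> : r ^- 2 = 1 - r^-1 * la by field; rewrite r0.
rewrite scalerBl scalerBl scale1r scale1r {1}d_T ract_wbE.
by rewrite scalerDr scale_kAA opprD [LHS]addrC -!addrA.
Qed.

Lemma nu_circ_beta : beta - nu circ = - ((sgc ^+ 2 - 1) * (sgc ^+ 2 / r)).
Proof. by rewrite nu_circ; ring. Qed.

Lemma d_T_right : exists h : 'I_N.+2 -> K, (forall D, h D != 0) /\
  forall C, d (T C bullet) = \sum_D ract (h D *: T C D) (omega D).
Proof.
(* The factor [r ^+ 2] undoes the one in [d_T_twisted]; the [nu D] come from [tau_right]. *)
exists (fun D => r ^+ 2 * (if D == circ then beta - nu circ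
  else if D == bullet then - r^-1 else - nu D)); split=> [D|C].
  rewrite mulf_neq0 ?expf_neq0 //; have [->|[b ->]|->] := indexP D; rewrite !index_eqE.
  - by rewrite nu_circ_beta oppr_eq0 !mulf_neq0 ?subr_eq0 ?expf_neq0 ?invr_eq0.
  - by rewrite oppr_eq0 nu_mid !mulf_neq0 ?expf_neq0 ?invr_eq0.
  by rewrite oppr_eq0 invr_eq0.
transitivity ((r ^+ 2)%:A *: ((r ^- 2)%:A *: d (T C bullet))).
  by rewrite scale_kAA mulfV ?expf_neq0 // scale1r scale1r.
under eq_bigr do rewrite -scalerA ractZ.
rewrite -scaler_sumr; congr (_ *: _).
rewrite d_T_twisted [(beta *: _) *: _]scale_kA lmul_oc tau_right !big_index !index_eqE.
rewrite nu_bullet scale0r.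
rewrite ract0l addr0; set S := \sum_a ract _ _.
rewrite [X in _ = _ + X + _](_ : _ = - S); last first.
  rewrite /S -sumrN; apply: eq_bigr => b _.
  by rewrite !index_eqE ractZ scaleNr scaleNr -ractZ.
rewrite !ractZ scaleNr scaleNr [(beta - _)%:A]scalerBl [(_ - _) *: _]scalerBl.
rewrite opprD [LHS]addrC -!addrA; congr (_ + _).
by rewrite [LHS]addrC -addrA.
Qed.

Lemma Dz_independent_l : independent (@form_lmul N A) Dz.
Proof.
move=> c; have [c' [c'E ->]] := big_plane_index c (@form_lmul N A).
have [h [h0 hE]] := d_T_left.
move=> H i; rewrite -c'E; apply: T_row_indep => D.
have cE C : (form_lmul (c' C) (d (T C bullet)) : forms) 0 D = h D *: (c' C * T C D).
  rewrite /form_lmul hE mxE summxE (@sum_only1 _ _ D) => [|E].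
    by rewrite !mxE !eqxx mulr1 -scalerAr.
  rewrite !mxE eqxx [D == E]eq_sym /=; case: (E =P D) => // _.
  by rewrite mulr0 eqxx.
have : (\sum_C form_lmul (c' C) (d (T C bullet)) : forms) 0 D = 0 by rewrite H mxE.
rewrite summxE; under eq_bigr do rewrite cE.
by move=> /eqP; rewrite -scaler_sumr scaler_eq0 (negbTE (h0 D)) => /eqP.
Qed.

Lemma ract_sumr (I : Type) (t : seq I) (P : I -> A) w :
  ract (\sum_(i <- t) P i) w = \sum_(i <- t) ract (P i) w.
Proof.
elim/big_rec2: _ => [|i y y' _ <-]; last by rewrite ractDl.
exact: ract0l.
Qed.

Lemma Dz_independent_r : independent ract Dz.
Proof.
move=> c; have [c' [c'E ->]] := big_plane_index c ract.
have [h [h0 hE]] := d_T_right.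
move=> H i; rewrite -c'E; apply: T_col_indep => D.
have H' : \sum_E ract (h E *: \sum_C T C E * c' C) (omega E) = 0.
  rewrite -[RHS]H.
  under [RHS]eq_bigr do rewrite hE ract_sum.
  rewrite exchange_big; apply: eq_bigr => E _ /=.
  rewrite scaler_sumr ract_sumr; apply: eq_bigr => C _.
  by rewrite ractM scalerAl.
have /eqP := ract_omega_indep H' D.
by rewrite scaler_eq0 (negbTE (h0 D)) => /eqP.
Qed.

Lemma Gamma_Dz i : Gamma (Dz i).
Proof.
by case: i => [a|[]]; apply: Gamma_d; [exact: plane_x|exact: plane_v|exact: plane_z].
Qed.

Lemma free_Dz_l : freely_generated (@form_lmul N A) M Gamma Dz.
Proof.
apply: (freely_generated_intro lmul_action).
- exact: Gamma_submodule_l.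
- exact: Gamma_Dz.
- move=> w /Gamma_lspan_frame; apply: span_min => //; exact: frame_lspan.
exact: Dz_independent_l.
Qed.

Lemma free_Dz_r : freely_generated ract M Gamma Dz.
Proof.
apply: (freely_generated_intro ract_action).
- exact: Gamma_submodule_r.
- exact: Gamma_Dz.
- move=> w /Gamma_rspan_frame; apply: span_min => //; exact: frame_rspan.
exact: Dz_independent_r.
Qed.

(** * Exchanging dz for dL *)

Local Notation DL := (diff_family T d (quad_L T s)).

Lemma d_scale k a : d (k *: a) = k%:A *: d a.
Proof.
rewrite !dE /inner_diff ractZ [(k *: a) *: _]scale_kA -scalerBr.
by rewrite !scale_kAA mulrC.
Qed.

(** Up to a scalar dv is [v *: wb], and moving z past omega^bullet creates the dz term. *)
Lemma ract_z_d_v : ract z (d v) = (r ^- 2)%:A *: (z *: d v)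
  - (r^-1 * la)%:A *: (v *: d z).
Proof.
rewrite {1}d_v ractN ract_lmul ract_lmul ract_wbE.
rewrite scalerDr lmul_kA scalerDr scale_kAA opprD [LHS]addrC; congr (_ + _).
rewrite d_v scalerN lmul_kA [z *: (v *: _)]scalerA mul_zv.
rewrite [(r ^+ 2 *: _) *: _]scale_kA [v *: (z *: _)]scalerA scalerN !scale_kAA.
by congr (- (_%:A *: _)); field; rewrite r0.
Qed.

Lemma d_vz : v *: d z + ract z (d v) = (r ^- 2)%:A *: (v *: d z + z *: d v).
Proof.
rewrite ract_z_d_v addrCA scalerDr addrC; congr (_ + _).
have -> : r ^- 2 = 1 - r^-1 * la by field; rewrite r0.
by rewrite scalerBl scalerBl scale1r scale1r.
Qed.

Lemma d_quad_L_l : d (quad_L T s) = (- (kap / r ^+ 2) *: v) *: d z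
  + (- (kap / r ^+ 2) *: z) *: d v.
Proof.
rewrite quad_LE -scaleNr d_scale d_leibniz d_vz scale_kAA scalerDr.
by rewrite [(_ *: v) *: _]scale_kA [(_ *: z) *: _]scale_kA mulNr.
Qed.

(** Obtained by differentiating [mul_zv]: after [d_vz] both sides contain z dv, which cancels. *)
Lemma ract_v_d_z : ract v (d z) = v *: d z.
Proof.
have := d_leibniz z v; rewrite mul_zv d_scale d_leibniz d_vz scale_kAA.
rewrite mulfV ?expf_neq0 // scale1r scale1r addrC => /addrI.
exact: esym.
Qed.

Lemma d_quad_L_r : d (quad_L T s) = ract (- kap *: v) (d z)
  + ract (- kap *: z) (d v).
Proof.
by rewrite quad_LE -scaleNr d_scale d_leibniz -ract_v_d_z !ractZ scalerDr.
Qed.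

Lemma free_DL_l : freely_generated (@form_lmul N A) M Gamma DL.
Proof.
have r20 : r ^+ 2 != 0 by rewrite expf_neq0.
apply: (proj1 (freely_generated_change (i0 := inr false) (i1 := inr true)
  (m := - (kap / r ^+ 2) *: v) (m' := - (r ^+ 2 / kap) *: u)
  (n := - (kap / r ^+ 2) *: z) lmul_action plane_subring_l _ _ _ _ _ _ _ _ _ _ _
  free_Dz_l Dz_independent_l)) => //.
- exact: plane_Z.
- exact: plane_Z.
- rewrite -scalerAl -scalerAr scalerA mul_uv mulrNN mulrA divfK // mulfV //.
  by rewrite scale1r.
- rewrite -scalerAl -scalerAr scalerA mul_vu mulrNN mulrA divfK // mulfV //.
  by rewrite scale1r.
- exact: mulrA.
- exact: mulr1.
- exact: mul0r.
- by case=> [a|[]].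
- exact: d_quad_L_l.
by apply: Gamma_d; exact: plane_quad_L.
Qed.

Lemma free_DL_r : freely_generated ract M Gamma DL.
Proof.
apply: (proj1 (freely_generated_change (i0 := inr false) (i1 := inr true)
  (m := - kap *: v) (m' := - kap^-1 *: u)
  (n := - kap *: z) ract_action plane_subring_r _ _ _ _ _ _ _ _ _ _ _
  free_Dz_r Dz_independent_r)) => //.
- exact: plane_Z.
- exact: plane_Z.
- by rewrite -scalerAl -scalerAr scalerA mul_vu mulrNN mulfV // scale1r.
- by rewrite -scalerAl -scalerAr scalerA mul_uv mulrNN mulVf // scale1r.
- by move=> a b c; rewrite mulrA.
- exact: mul1r.
- exact: mulr0.
- by case=> [a|[]].
- exact: d_quad_L_r.
by apply: Gamma_d; exact: plane_quad_L.
Qed.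

End Inhomogeneous.

(** * The theorem *)

Section Assembly.
Context {K : fieldType} {N : nat} (r s : K) (q : 'I_N.+2 -> 'I_N.+2 -> K).
Hypotheses (r0 : r != 0) (s2 : s ^+ 2 = r) (qP : multiparameters r q).
Variables (SO : algType K) (p : {lrmorphism free_algebra (K := K) N -> SO}).
Hypothesis pP : is_quotient p (so_relator r s q).
Variables (Delta : SO -> seq (SO * SO)) (eps : {lrmorphism SO -> K^o}).
Variables (kappa : SO -> SO) (Lp Lm : 'I_N.+2 -> 'I_N.+2 -> SO -> K).
Hypotheses (DeltaP : is_coproduct (gen_image p) Delta)
  (epsP : is_counit (gen_image p) eps)
  (kappaP : is_antipode (gen_image p) s kappa)
  (LpP : is_Lplus (gen_image p) r s q Lp)
  (LmP : is_Lminus (gen_image p) r s q Lm).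
Variables (ISO : algType K) (pi : {lrmorphism SO -> ISO}).
Hypothesis piP : is_quotient pi (iso_relator (gen_image p)).
Hypotheses (r_neq1 : r != 1) (r_neqN1 : r != -1) (rN_neq1 : r ^+ N != 1)
  (rN2_neq : 1 + r ^ (N%:Z - 2) != 0).

Local Notation T := (fun A B => pi (gen_image p A B)).
Local Notation f := (f_fun Delta kappa Lp Lm).
Local Notation Delta' := (induced_coproduct pi Delta).
Local Notation f' := (fun B D => induced_functional pi (f B D)).
Local Notation chi' :=
  (fun B => induced_functional pi (chi_fun r eps f B)).
Local Notation d := (form_diff Delta' chi').
Local Notation M := (plane T).
Local Notation Gamma_M := (forms_on Delta' chi' M).
Local Notation sgc := (s ^ (rho2 (@circ N))).

Let s0 : s != 0.
Proof. by move: r0; rewrite -s2 expf_eq0. Qed.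

Let la0 : r - r^-1 != 0.
Proof.
rewrite subr_eq0; apply/eqP => rV; move/eqP: (congr1 ( *%R r) rV).
by rewrite mulfV // -expr2 sqrf_eq1 (negbTE r_neq1) (negbTE r_neqN1).
Qed.

Let sgc2 : sgc ^+ 2 = r ^+ N.
Proof. by rewrite rho2_circ -s2 -exprnP exprAC. Qed.

Let sgc1 : sgc ^+ 2 != 1. Proof. by rewrite sgc2. Qed.

Let kap0 : sgc^-1 * r ^+ 2 + sgc != 0.
Proof.
have S0 := expfz_neq0 (rho2 (@circ N)) s0.
(* As [sgc ^+ 2] is r^N, the last factor is 1 + r^(N-2). *)
have -> : sgc^-1 * r ^+ 2 + sgc = sgc^-1 * r ^+ 2 * (1 + sgc ^+ 2 / r ^+ 2).
  by field; rewrite r0 S0.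
rewrite !mulf_neq0 ?invr_eq0 ?expf_neq0 // sgc2.
by move: rN2_neq; rewrite expfzDr // -exprnP -exprnN.
Qed.

Let gT : generated_by (gen_image p) := free_algebra_image (proj1 pP).
Let gT' : generated_by T := generated_quotient (proj1 piP) gT.
Let Ru : Rmx r s q \in unitmx := Rmx_unitmx s0 pP LmP.
Let cross := Lminus_crossing pP LmP.
Let fP := f_functional s0 r0 qP gT DeltaP kappaP LpP LmP.
Let gP := g_functional s0 pP r0 qP gT DeltaP kappaP LpP LmP.


Local Notation F := (fun B D => left_action Delta' (f' B D)).
Local Notation g := (fun B C => fun a : SO =>
  (s ^ (rho2 B) / s ^ (rho2 C)) ^+ 2 * f C B (kappa a)).
Local Notation G := (fun B C => left_action Delta' (induced_functional pi (g B C))).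

Let fval0 B D C E : ideal_position C E -> fval r s q B D C E = 0.
Proof. exact: (fval_ideal_position s0 pP r0 qP LmP). Qed.

Let gval0 B D C E : ideal_position C E -> gval r s q B D C E = 0.
Proof. exact: (gval_ideal_position s0 pP r0 qP LmP). Qed.

Let FP : is_matrix_operator T F (fval r s q) :=
  induced_operator piP DeltaP fP fval0.
Let GP : is_matrix_operator T G (gval r s q) :=
  induced_operator piP DeltaP gP gval0.

Let FG B E a : \sum_D F D E (G D B a) = a *+ (B == E).
Proof.
apply: (operator_invr gT' FP GP) => {}B {}E C J.
exact: (gf_inverse s0 pP r0 qP gT DeltaP kappaP LpP LmP).
Qed.

Let GF B E a : \sum_D G E D (F B D a) = a *+ (B == E).
Proof.
apply: (operator_invl gT' FP GP) => {}B {}E C J.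
exact: (fg_inverse s0 pP r0 qP gT DeltaP kappaP LpP LmP).
Qed.

Let T0 C E : ideal_position C E -> T C E = 0.
Proof. exact: (iso_gen0 piP). Qed.

Let RTT B C D E :
  \sum_G \sum_F Rmat r s q B C G F *: (T G D * T F E)
  = \sum_G \sum_F Rmat r s q G F D E *: (T C F * T B G).
Proof.
apply: etrans (etrans (congr1 pi (so_RTT pP B C D E)) _).
  exact/esym/(lrmorphism_quadratic pi _ (fun G' _ => gen_image p G' D)).
exact: (lrmorphism_quadratic pi _ (fun _ F' => gen_image p C F')).
Qed.

Let TCT B D : \sum_F (s ^ (rho2 F))^-1 *: (T F B * T (rev_ord F) D)
  = ((s ^ (rho2 B))^-1 *+ (B == rev_ord D))%:A.
Proof.
have := congr1 pi (so_metric pP B D); rewrite linearZ rmorph1 => <-.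
by rewrite linear_sum; apply: eq_bigr => E _; rewrite linearZ rmorphM.
Qed.

Let TTC B D : \sum_F (s ^ (rho2 F))^-1 *: (T B F * T D (rev_ord F))
  = ((s ^ (rho2 B))^-1 *+ (B == rev_ord D))%:A.
Proof.
have := congr1 pi (so_metric_inv s0 pP B D); rewrite linearZ rmorph1 => <-.
by rewrite linear_sum; apply: eq_bigr => E _; rewrite linearZ rmorphM.
Qed.

Let dE a : d a = inner_diff r F a.
Proof.
apply/rowP => B; rewrite !mxE (induced_chi piP gT DeltaP fP fval0 _ _ _ epsP).
rewrite -scalerAl mul1r (@sum_only1 _ _ bullet) => [|E].
  by rewrite mxE !eqxx mul1r mulr_natr [B == _]eq_sym.
by rewrite mxE /=; case: (E =P bullet) => // _; rewrite mul0r eqxx.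
Qed.

Let GammaP w : Gamma_M w <-> exists t : seq (ISO * ISO),
  (forall y, y \in t -> M y.1 /\ M y.2) /\ w = \sum_(y <- t) y.1 *: d y.2.
Proof. by []. Qed.

Theorem plane_forms_free :
  [/\ @freely_generated ISO (forms N ISO) form_lmul M Gamma_M _
        (diff_family T d (quad_L T s)),
      @freely_generated ISO (forms N ISO) (form_rmul Delta' f') M Gamma_M _
        (diff_family T d (quad_L T s)),
      @freely_generated ISO (forms N ISO) form_lmul M Gamma_M _
        (diff_family T d (gen_z T)) &
      @freely_generated ISO (forms N ISO) (form_rmul Delta' f') M Gamma_M _
        (diff_family T d (gen_z T))].
Proof.
split.
- exact: (free_DL_l r0 s0 qP la0 cross Ru T0 RTT TCT TTC FP sgc1 kap0 dE GammaP).
- exact: (free_DL_r r0 s0 qP la0 cross Ru T0 RTT TCT TTC FP GP FG GF sgc1 kap0 dE GammaP).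
- exact: (free_Dz_l r0 s0 qP la0 cross Ru T0 RTT TCT TTC FP sgc1 kap0 dE GammaP).
exact: (free_Dz_r r0 s0 qP la0 cross Ru T0 RTT TCT TTC FP GP FG GF sgc1 kap0 dE GammaP).
Qed.

End Assembly.

Local Open Scope complex_scope.

Theorem proposition5p1 (R : realType) (N : nat)
  (r s : R[i]) (q : 'I_N.+2 -> 'I_N.+2 -> R[i])
  (r_neq0 : r != 0) (s_sqrt : s ^+ 2 = r) (q_param : multiparameters r q)
  (* SO_{q,r}(N+2), its Hopf structure and the functionals L^+, L^- *)
  (SO : algType R[i]) (p : {lrmorphism free_algebra (K := R[i]) N -> SO})
  (SO_quotient : is_quotient p (so_relator r s q))
  (Delta : SO -> seq (SO * SO)) (eps : {lrmorphism SO -> R[i]^o})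
  (kappa : SO -> SO) (Lp Lm : 'I_N.+2 -> 'I_N.+2 -> SO -> R[i])
  (Delta_coproduct : is_coproduct (gen_image p) Delta)
  (eps_counit : is_counit (gen_image p) eps)
  (kappa_antipode : is_antipode (gen_image p) s kappa)
  (Lp_plus : is_Lplus (gen_image p) r s q Lp)
  (Lm_minus : is_Lminus (gen_image p) r s q Lm)
  (* ISO_{q,r}(N) *)
  (ISO : algType R[i]) (pi : {lrmorphism SO -> ISO})
  (ISO_quotient : is_quotient pi (iso_relator (gen_image p)))
  (r_neq1 : r != 1) (r_neqN1 : r != -1) (rN_neq1 : r ^+ N != 1)
  (rN2_neq : 1 + r ^ (N%:Z - 2) != 0) :
  let T := fun A B => pi (gen_image p A B) in
  let f := f_fun Delta kappa Lp Lm in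
  let chi := chi_fun r eps f in
  let Delta' := induced_coproduct pi Delta in
  let f' := fun B D => induced_functional pi (f B D) in
  let chi' := fun B => induced_functional pi (chi B) in
  let d := form_diff Delta' chi' in
  let M := plane T in
  let Gamma_M := forms_on Delta' chi' M in
  [/\ @freely_generated ISO (forms N ISO) form_lmul M Gamma_M _
        (diff_family T d (quad_L T s)),
      @freely_generated ISO (forms N ISO) (form_rmul Delta' f') M Gamma_M _
        (diff_family T d (quad_L T s)),
      @freely_generated ISO (forms N ISO) form_lmul M Gamma_M _
        (diff_family T d (gen_z T)) &
      @freely_generated ISO (forms N ISO) (form_rmul Delta' f') M Gamma_M _
        (diff_family T d (gen_z T))].
Proof.
exact: (plane_forms_free r_neq0 s_sqrt q_param SO_quotient Delta_coproduct
  eps_counit kappa_antipode Lp_plus Lm_minus ISO_quotient r_neq1 r_neqN1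
  rN_neq1 rN2_neq).
Qed.
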